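(* Let $q$ be a prime power, let $\Delta_1,\Delta_2,\Delta_3\subset\mathbb Z/(q^2+q+1)$ be three classical difference sets containing $0$, let $J=\{0,1,\dots,q\}$, and let $\delta_\alpha:J\to\Delta_\alpha$ ($\alpha\in\{1,2,3\}$) be bijections satisfying $\delta_\alpha(0)=0$. Then the group with presentation $$\Gamma=\bigl\langle\sigma_1,\sigma_2,\sigma_3\ \big|\ \sigma_1^{q^2+q+1}=\sigma_2^{q^2+q+1}=\sigma_3^{q^2+q+1}=1,\ \ \sigma_1^{\delta_1(j)}\sigma_2^{\delta_2(j)}\sigma_3^{\delta_3(j)}=1\quad\forall j\in J\bigr\rangle$$ is a uniform lattice in a building of type $\tilde A_2$.
   Context: The classical projective plane of order $q$ (over $\mathbb F_q$) admits cyclic Singer groups, i.e. cyclic groups $S=\langle\sigma\rangle$ of automorphisms of order $q^2+q+1$ acting regularly on points (and on lines). For a point $p$ and a line $l$, the associated classical difference set is $\Delta=\{\delta\in\mathbb Z/(q^2+q+1):p\text{ is incident with }\sigma^\delta(l)\}$; it has $q+1$ elements and contains $0$ exactly when $p$ and $l$ are incident. ''Uniform lattice in a building $X$'' means a discrete cocompact subgroup of the full automorphism group $\mathrm{Aut}(X)$ of the locally finite building $X$, with the topology for which stabilisers of compact sets form a neighbourhood basis of the identity; equivalently a group acting faithfully and cocompactly on $X$ with finite stabilisers. *)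

(* Defs.v *)
From HB Require Import structures.
From mathcomp Require Import all_boot all_order all_algebra all_fingroup.
From mathcomp Require Import generic_quotient boolp classical_sets cardinality.

Set Implicit Arguments.
Unset Strict Implicit.
Unset Printing Implicit Defensive.

(* The group <I | R>.  A word is a sequence of letters (i, b), where (i, true)
   stands for the generator i and (i, false) for its inverse; R is the set of
   relators, each r in R standing for the relation r = 1. *)

Definition word (I : Type) : Type := seq (I * bool).

HB.instance Definition _ (I : choiceType) := Choice.copy (word I) (seq (I * bool)).

Definition word_inv (I : Type) (w : word I) : word I :=
  rev [seq (x.1, ~~ x.2) | x <- w].

Inductive word_eq (I : Type) (R : word I -> Prop) : word I -> word I -> Prop :=
| word_eq_refl w : word_eq R w w
| word_eq_sym v w : word_eq R v w -> word_eq R w v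
| word_eq_trans u v w : word_eq R u v -> word_eq R v w -> word_eq R u w
| word_eq_cat v v' w w' :
    word_eq R v v' -> word_eq R w w' -> word_eq R (v ++ w) (v' ++ w')
| word_eq_cancel i b : word_eq R [:: (i, b); (i, ~~ b)] [::]
| word_eq_rel r : R r -> word_eq R r [::].

Section Presentation.
Context (I : choiceType) (R : word I -> Prop).

Definition word_eqb (v w : word I) : bool := `[< word_eq R v w >].

Lemma word_eqb_refl : reflexive word_eqb.
Proof. by move=> w; apply/asboolP; exact: word_eq_refl. Qed.

Lemma word_eqb_sym : symmetric word_eqb.
Proof.
by move=> v w; apply/idP/idP => /asboolP e; apply/asboolP; exact: word_eq_sym.
Qed.

Lemma word_eqb_trans : transitive word_eqb.
Proof.
move=> v u w /asboolP uv /asboolP vw; apply/asboolP.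
exact: word_eq_trans uv vw.
Qed.

Canonical word_equiv := EquivRel word_eqb word_eqb_refl word_eqb_sym word_eqb_trans.

Local Open Scope quotient_scope.

Definition presented : Type := {eq_quot word_equiv}.

HB.instance Definition _ := Choice.copy presented {eq_quot word_equiv}.

Definition wclass (w : word I) : presented := \pi_{eq_quot word_equiv} w.

Definition gen (i : I) : presented := wclass [:: (i, true)].

Definition pres_mul (x y : presented) : presented :=
  wclass (repr (x : {eq_quot word_equiv}) ++ repr (y : {eq_quot word_equiv})).
Definition pres_one : presented := wclass [::].
Definition pres_inv (x : presented) : presented :=
  wclass (word_inv (repr (x : {eq_quot word_equiv}))).

Lemma wclassP v w : wclass v = wclass w <-> word_eq R v w.
Proof.
split=> [/eqmodP/asboolP //|e]; apply/eqmodP; exact/asboolP.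
Qed.

Lemma wclass_surj (x : presented) : exists w, x = wclass w.
Proof. by exists (repr (x : {eq_quot word_equiv})); rewrite /wclass reprK. Qed.

Lemma repr_wclass w : word_eq R (repr (wclass w : {eq_quot word_equiv})) w.
Proof. by apply/wclassP; rewrite /wclass reprK. Qed.

Lemma wclassM v w : pres_mul (wclass v) (wclass w) = wclass (v ++ w).
Proof. by apply/wclassP; apply: word_eq_cat; exact: repr_wclass. Qed.

Lemma word_invK (w : word I) : word_inv (word_inv w) = w.
Proof.
rewrite /word_inv map_rev revK -map_comp -[RHS]map_id.
by apply: eq_map => -[i b] /=; rewrite negbK.
Qed.

Lemma word_mulVw (w : word I) : word_eq R (word_inv w ++ w) [::].
Proof.
elim: w => [|[i b] w IH]; first exact: word_eq_refl.
rewrite /word_inv /= rev_cons cat_rcons.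
apply: word_eq_trans IH; apply: word_eq_cat; first exact: word_eq_refl.
rewrite -[X in word_eq R _ X]cat0s -[(i, ~~ b) :: _]/([:: _; _] ++ w).
apply: word_eq_cat; last exact: word_eq_refl.
by rewrite -{2}[b]negbK; exact: word_eq_cancel.
Qed.

Lemma pres_mulA : associative pres_mul.
Proof.
move=> x y z; have [[u ->] [v ->] [w ->]] :=
  And3 (wclass_surj x) (wclass_surj y) (wclass_surj z).
by rewrite !wclassM catA.
Qed.

Lemma pres_mul1 : left_id pres_one pres_mul.
Proof. by move=> x; have [w ->] := wclass_surj x; rewrite wclassM. Qed.

Lemma pres_mulr1 : right_id pres_one pres_mul.
Proof. by move=> x; have [w ->] := wclass_surj x; rewrite wclassM cats0. Qed.

Lemma pres_mulV : left_inverse pres_one pres_inv pres_mul.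
Proof.
move=> x; rewrite -[X in pres_mul _ X](reprK (x : {eq_quot word_equiv})).
by rewrite [LHS]wclassM; apply/wclassP; exact: word_mulVw.
Qed.

Lemma pres_mulrV : right_inverse pres_one pres_inv pres_mul.
Proof.
move=> x; rewrite -[X in pres_mul X _](reprK (x : {eq_quot word_equiv})).
rewrite [LHS]wclassM; apply/wclassP.
rewrite -{1}[repr _]word_invK; exact: word_mulVw.
Qed.

HB.instance Definition _ := isGroup.Build presented
  pres_mulA pres_mul1 pres_mulr1 pres_mulV pres_mulrV.

End Presentation.

(* m i j = 0 encodes m i j = infinity. *)
Record coxeter_matrix (I : finType) := CoxeterMatrix {
  cox_m :> I -> I -> nat;
  cox_m_diag : forall i, cox_m i i = 1;
  cox_m_offdiag : forall i j, i != j -> cox_m i j != 1;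
  cox_m_sym : forall i j, cox_m i j = cox_m j i
}.

Section Coxeter.
Context (I : finType) (m : coxeter_matrix I).

Definition cox_relator (r : word I) : Prop :=
  exists i j : I, 0 < m i j /\ r = flatten (nseq (m i j) [:: (i, true); (j, true)]).

Definition coxeter_group : groupType := presented cox_relator.

Definition cox_gen (i : I) : coxeter_group := gen cox_relator i.

Definition cox_word (s : seq I) : coxeter_group := (\prod_(i <- s) cox_gen i)%g.

Lemma cox_wordE (s : seq I) :
  cox_word s = wclass cox_relator [seq (i, true) | i <- s].
Proof.
rewrite /cox_word; elim: s => [|i s IH]; first by rewrite big_nil.
by rewrite big_cons IH; exact: (wclassM _ [:: _]).
Qed.

Lemma cox_word_surj (w : coxeter_group) : exists s, cox_word s = w.
Proof.
have [v ->] := wclass_surj w; exists [seq x.1 | x <- v].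
rewrite cox_wordE; apply/wclassP; elim: v => [|[i b] v IH] /=.
  exact: word_eq_refl.
apply: (@word_eq_cat _ _ [:: _] [:: _]) IH; case: b; first exact: word_eq_refl.
have ii : word_eq cox_relator [:: (i, true); (i, true)] [::].
  by apply: word_eq_rel; exists i, i; rewrite cox_m_diag.
apply: (@word_eq_trans _ _ _ ([:: (i, true); (i, true)] ++ [:: (i, false)])).
  apply: word_eq_sym; apply: (@word_eq_cat _ _ [:: _] [:: _]).
    exact: word_eq_refl.
  exact: (word_eq_cancel _ i true).
rewrite -[X in word_eq _ _ X]cat0s.
by apply: word_eq_cat => //; exact: word_eq_refl.
Qed.

Lemma cox_length_exists (w : coxeter_group) :
  exists k, `[< exists s, size s = k /\ cox_word s = w >].
Proof.
by have [s sw] := cox_word_surj w; exists (size s); apply/asboolP; exists s.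
Qed.

Definition cox_length (w : coxeter_group) : nat := ex_minn (cox_length_exists w).

Definition parabolic (J : {set I}) (w : coxeter_group) : Prop :=
  exists s : seq I, {subset s <= J} /\ w = cox_word s.

(* Buildings as sets of chambers with a Weyl-group valued distance. *)
Record building := Building {
  chamber :> Type;
  wdist : chamber -> chamber -> coxeter_group;
  building_inhabited : inhabited chamber;
  building_WD1 : forall C D, wdist C D = 1%g <-> C = D;
  building_WD2 : forall (C C' D : chamber) (s : I),
    wdist C' C = cox_gen s ->
    (wdist C' D = cox_gen s * wdist C D \/ wdist C' D = wdist C D)%g /\
    (cox_length (cox_gen s * wdist C D)%g = (cox_length (wdist C D)).+1 ->
     wdist C' D = cox_gen s * wdist C D)%g;
  building_WD3 : forall (C D : chamber) (s : I),
    exists C', wdist C' C = cox_gen s /\ (wdist C' D = cox_gen s * wdist C D)%g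
}.

Section Building.
Context (X : building).

Local Open Scope classical_set_scope.

(* The simplices of X are the residues of proper type J; the one of type J
   through C is the face of cotype J of the chamber C.  In particular the
   vertices are the residues of type ~: [set i]. *)
Definition residue (J : {set I}) (C : X) : set X :=
  [set D | parabolic J (wdist C D)].

Definition locally_finite : Prop :=
  forall (J : {set I}) (C : X), J \proper finset.setTfor I ->
    finite_set (residue J C).

(* Not necessarily type-preserving: the types may be permuted by an
   automorphism t of the Coxeter diagram. *)
Definition building_automorphism (f : X -> X) : Prop :=
  bijective f /\
  exists t : {perm I},
    (forall i j, m (t i) (t j) = m i j) /\
    (forall (C D : X) (s : seq I),
       wdist C D = cox_word s -> wdist (f C) (f D) = cox_word (map t s)).

(* G is (identified, by means of a faithful action, with) a uniform lattice:
   a group of automorphisms acting cocompactly with finite stabilisers on the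
   locally finite building X.  Since X is locally finite, cocompactness means
   that there are finitely many orbits of chambers. *)
Definition uniform_lattice (G : groupType) : Prop :=
  locally_finite /\
  exists act : G -> X -> X,
    [/\ (forall C, act 1%g C = C) /\
          (forall g h C, act (g * h)%g C = act g (act h C)),
        forall g, building_automorphism (act g),
        forall g, (forall C, act g C = C) -> g = 1%g,
        exists Y : set X, finite_set Y /\
          forall C, exists g D, Y D /\ C = act g D
      & forall (J : {set I}) (C : X), J \proper finset.setTfor I ->
          finite_set [set g | act g @` residue J C = residue J C]].

End Building.
End Coxeter.

Definition A2_tilde_m (i j : 'I_3) : nat := if i == j then 1 else 3.

Lemma A2_tilde_diag i : A2_tilde_m i i = 1.
Proof. by rewrite /A2_tilde_m eqxx. Qed.

Lemma A2_tilde_offdiag i j : i != j -> A2_tilde_m i j != 1.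
Proof. by rewrite /A2_tilde_m => /negPf ->. Qed.

Lemma A2_tilde_sym i j : A2_tilde_m i j = A2_tilde_m j i.
Proof. by rewrite /A2_tilde_m eq_sym. Qed.

Definition A2_tilde : coxeter_matrix 'I_3 :=
  CoxeterMatrix A2_tilde_diag A2_tilde_offdiag A2_tilde_sym.

Section Plane.
Context (F : finFieldType).

(* Subspaces of F^3 of vector space dimension k. *)
Definition flat (k : nat) : Type := {U : {vspace 'rV[F]_3} | \dim U == k}.
Definition point : Type := flat 1.
Definition line : Type := flat 2.

Definition incident (p : point) (l : line) : bool := (sval p <= sval l)%VS.

Record plane_automorphism := PlaneAutomorphism {
  on_points : point -> point;
  on_lines : line -> line;
  on_points_bij : bijective on_points;
  on_lines_bij : bijective on_lines;
  plane_aut_incident :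
    forall p l, incident (on_points p) (on_lines l) = incident p l
}.

End Plane.

Definition singer_order (q : nat) : nat := q ^ 2 + q + 1.

(* s generates a cyclic group of order q^2 + q + 1 that is regular on points
   and on lines. *)
Definition singer_generator (F : finFieldType) (s : plane_automorphism F) : Prop :=
  let N := singer_order #|F| in
  [/\ iter N (on_points s) =1 id, iter N (on_lines s) =1 id,
      forall p p' : point F, exists! k : 'I_N, iter k (on_points s) p = p'
    & forall l l' : line F, exists! k : 'I_N, iter k (on_lines s) l = l'].

(* As q^2 + q + 1 > 1 for q > 0, 'Z_(q^2 + q + 1) is Z/(q^2 + q + 1). *)
Definition classical_difference_set (q : nat)
    (D : {set 'Z_(singer_order q)}) : Prop :=
  exists (F : finFieldType) (s : plane_automorphism F) (p : point F) (l : line F),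
    [/\ #|F| = q, singer_generator s
      & forall d : 'Z_(singer_order q),
          (d \in D) = incident p (iter d (on_lines s) l)].

Section Gamma.
Context (q : nat) (delta : 'I_3 -> 'I_q.+1 -> 'Z_(singer_order q)).

Definition sigma_pow (a : 'I_3) (k : nat) : word 'I_3 := nseq k (a, true).

(* The three generators are indexed by 0, 1, 2 : 'I_3; exponents in
   Z/(q^2 + q + 1) are lifted to their least nonnegative representatives. *)
Definition Gamma_relator (r : word 'I_3) : Prop :=
  (exists a, r = sigma_pow a (singer_order q)) \/
  (exists j, r = sigma_pow 0%R (delta 0%R j) ++
                 sigma_pow 1%R (delta 1%R j) ++
                 sigma_pow 2%R (delta 2%R j)).

Definition Gamma : groupType := presented Gamma_relator.

End Gamma.

(* Main.v *)
Require Import Defs.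
From mathcomp Require Import all_boot all_order all_algebra all_fingroup.
From mathcomp Require Import generic_quotient boolp classical_sets cardinality.
From mathcomp Require Import ring zify.

(** A chamber is a pair (g, j) of a group element and an index j in J.  Its
    three panels are g, g sigma_0^(delta_0 j) and
    g sigma_0^(delta_0 j) sigma_1^(delta_1 j); the relation indexed by j closes
    this triangle, since it makes a further factor sigma_2^(delta_2 j) lead back
    to g.  Around a vertex one thus sees points and lines indexed by Z/N, where
    N = q^2 + q + 1, with flags (x, x + delta_a j).  Because two lines of the
    classical plane meet in exactly one point, every nonzero element of Z/N is a
    difference of two elements of a classical difference set in exactly one way
    ([classical_difference_onto], [classical_difference_uniq]), so that these
    flags form a projective plane.  Gamma acts by left translation, freely on
    chambers and with q + 1 orbits.  The substance of the theorem is that the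
    local planes fit together to a building.  This is an instance of the
    local-to-global principle of Tits, proved here by a normal form for
    galleries.

    In the triangular tiling a triangle is given by three integers (a, b, c)
    with a + b + c = 0 or -1, crossing a wall decreases a coordinate in the
    first case and increases one in the second, and the length of a shortest
    gallery from (0, 0, 0) is |a| + |b| + |c|.  Hence a gallery from the origin
    is shortest exactly if no coordinate is both increased and decreased.  Two
    shortest galleries with the same end differ by exchanging equal-parity steps
    two apart, that is, by going around a vertex on the other side; sorting the
    steps of each parity gives a normal form.  As there are three directions, at
    most one of the two parities uses two of them and none uses three, so that
    exchanges never overlap and no coherence condition arises.  In
    a geometry whose residues are projective planes a step also carries the
    label in J of the chamber reached, and an exchange changes the two
    intermediate labels in the way the plane prescribes ([hex]).

    The labelled normal forms starting from a chamber form a geometry with the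
    same local planes: inserting a step and removing a step are inverse to each
    other ([downP], [upK]), the exchange relation holds at the chambers nearest
    to the origin by the very definition of insertion ([cross_braid]), and this
    determines the whole plane around each vertex ([hexagon_chart],
    [nf_charts]).  The relators of Gamma act trivially on every geometry of this
    kind ([steps_word_eq]), so the chambers of Gamma map to the normal forms
    ([place_mv]); mapping a normal form back to its end is a one-sided inverse
    ([chamber_at_position]).  So each chamber has a well-defined normal gallery
    from each other chamber, and the Weyl distance is read off from its types.

    Two facts make this distance satisfy the axioms.  The length of the Weyl
    element of a normal form is its number of steps ([weyl_length]): applied to
    two labels and the difference set {0, 1} in Z/3, the same construction gives
    the tiling itself, on which the Coxeter group acts moving each chamber by at
    most one step per generator.  And the distance is symmetric up to inversion
    ([distanceC]), since a gallery whose type is reduced realizes the distance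
    and reversed galleries of reduced type have reduced type. *)

Set Implicit Arguments.
Unset Strict Implicit.
Unset Printing Implicit Defensive.

Import GRing.Theory.

Local Open Scope quotient_scope.
Local Open Scope ring_scope.

(** * Perfect difference families and closed hexagons *)

(** Three projective planes, one for each type of vertex: the flag labelled j at
    the point x of the plane a is (x, x + dlt a j).  The function dif finds the
    two labels with a given difference; at a nonzero difference they are unique,
    which says that two points lie on exactly one common line. *)
Record plane_data := PlaneData {
  coord : comNzRingType;
  label : eqType;
  dlt : 'I_3 -> label -> coord;
  dif : 'I_3 -> coord -> label * label;
  difE : forall a x, dlt a (dif a x).1 - dlt a (dif a x).2 = x;
  dlt_diff_inj : forall a u v u' v', dlt a u - dlt a v = dlt a u' - dlt a v' ->
    u != v -> u = u' /\ v = v'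
}.

Lemma eq_of_subr (R : pzRingType) (x y z t : R) : z = t -> x - y = z - t -> x = y.
Proof. by move=> ->; rewrite subrr => /eqP; rewrite subr_eq0 => /eqP. Qed.

Ltac ring_from e := first
  [ by apply: (eq_of_subr e); ring | by apply: (eq_of_subr (esym e)); ring ].

Section Hexagons.
Context (P : plane_data).
Implicit Types (a i k : 'I_3) (u v j l : label P).

(** The closed galleries of length six in the plane a are those through flags
    labelled l, u, v, j, v', u' in cyclic order whose alternating sum vanishes.
    The condition does not depend on whether the gallery starts with a change of
    point or a change of line, since that only changes its sign. *)
Definition closes a l u v j v' u' : Prop :=
  dlt a l - dlt a u + dlt a v - dlt a j + dlt a v' - dlt a u' = 0.

Lemma closes_flip a l u v j v' u' :
  closes a l u v j v' u' -> closes a l u' v' j v u.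
Proof. by rewrite /closes => e; ring_from e. Qed.

Lemma dlt_diff_cases a u v u' v' : dlt a u - dlt a v = dlt a u' - dlt a v' ->
  (u = v /\ u' = v') \/ (u = u' /\ v = v').
Proof.
move=> e; case: (eqVneq u v) => [uv|nuv]; last by right; exact: dlt_diff_inj e nuv.
case: (eqVneq u' v') => [|nuv]; first by left.
by have [] := dlt_diff_inj (esym e) nuv; right.
Qed.

Lemma dlt_inj a : injective (@dlt P a).
Proof.
move=> u v e; have /dlt_diff_cases : dlt a u - dlt a v = dlt a u - dlt a u.
  by rewrite e !subrr.
by case=> [[]|[]].
Qed.

(** The labels u', v' of the other gallery of length three, around the same
    vertex, from the flag l to the flag j reached through u and v. *)
Definition hex a l u v j : label P * label P :=
  dif a (dlt a l - dlt a u + dlt a v - dlt a j).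

Lemma hex_closes a l u v j :
  closes a l u v j (hex a l u v j).2 (hex a l u v j).1.
Proof.
by rewrite /closes /hex; set x := _ - dlt a j; have e := difE a x; ring_from e.
Qed.

Lemma dif_uniq a u v : u != v -> dif a (dlt a u - dlt a v) = (u, v).
Proof.
move=> nuv; have /esym e := difE a (dlt a u - dlt a v).
by case: (dlt_diff_inj e nuv) => {3}-> {3}->; case: dif.
Qed.

(** A stutter on the second half of a closed hexagon would leave four terms, and
    uniqueness of differences would then force one on the first half. *)
Lemma closes_nondegenerate a l u v j v' u' : closes a l u v j v' u' ->
  l != u -> u != v -> v != j -> [/\ j != v', v' != u' & u' != l].
Proof.
rewrite /closes => e lu uv vj; split; apply/eqP => f; subst.
- have f : dlt a u - dlt a v = dlt a l - dlt a u' by ring_from e.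
  by have [ul _] := dlt_diff_inj f uv; rewrite ul eqxx in lu.
- have f : dlt a u - dlt a v = dlt a l - dlt a j by ring_from e.
  by have [ul _] := dlt_diff_inj f uv; rewrite ul eqxx in lu.
- have f : dlt a u - dlt a v = dlt a v' - dlt a j by ring_from e.
  by have [_ vE] := dlt_diff_inj f uv; rewrite vE eqxx in vj.
Qed.

Lemma hex_uniq a l u v j v' u' : closes a l u v j v' u' -> u' != v' ->
  hex a l u v j = (u', v').
Proof.
rewrite /closes /hex => e; set x := (X in dif a X).
have -> : x = dlt a u' - dlt a v' by rewrite /x; ring_from e.
exact: dif_uniq.
Qed.

Lemma hex_nondegenerate a l u v j u' v' :
  l != u -> u != v -> v != j -> hex a l u v j = (u', v') ->
  [/\ l != u', u' != v', v' != j & hex a l u' v' j = (u, v)].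
Proof.
move=> lu uv vj h; have := hex_closes a l u v j; rewrite h /= => c.
have [n1 n2 n3] := closes_nondegenerate c lu uv vj.
rewrite eq_sym n3 eq_sym n2 eq_sym n1; split=> //.
by apply: hex_uniq => //; exact: closes_flip.
Qed.

(** The plane a has panels of the types a and a + 1.  As 0 + 1 + 2 = 0 in Z/3,
    this expression gives the plane of two distinct types without reference to
    their order. *)
Definition plane i k : 'I_3 := 1 - i - k.

Lemma planeC i k : plane i k = plane k i.
Proof. by rewrite /plane addrAC. Qed.

Lemma plane_succ i : plane i (i + 1) = i.
Proof. by apply: val_inj; case: i => [[|[|[|]]]]. Qed.

Lemma plane_cases i k : i != k ->
  (plane i k = i /\ k = i + 1) \/ (plane i k = k /\ i = k + 1).
Proof.
case: i => [[|[|[|//]]] ?]; case: k => [[|[|[|//]]] ?] // _;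
  by [left; split; apply: val_inj|right; split; apply: val_inj].
Qed.

End Hexagons.

(** * Chamber systems with prescribed planes as residues *)
Section Chart.
Context (P : plane_data) (C : Type) (mv : 'I_3 -> label P -> C -> C).

(** A covering of a residue by the flags of the plane a: x numbers the panels of
    type a and x + dlt a j those of type a + 1.  Identities between galleries in
    the plane carry over to the residue. *)
Record chart (a : 'I_3) (phi : coord P -> label P -> C) : Prop := Chart {
  chart_mv : forall x j j', mv a j' (phi x j) = phi x j';
  chart_mvS : forall x j j',
    mv (a + 1) j' (phi x j) = phi (x + dlt a j - dlt a j') j'
}.

Lemma chart_hexagon a phi i k x l u v j v' u' : chart a phi -> i != k ->
  plane i k = a -> closes a l u v j v' u' ->
  mv i j (mv k v (mv i u (phi x l))) = mv k j (mv i v' (mv k u' (phi x l))).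
Proof.
move=> ch ik pa; subst a; move: ch.
case/plane_cases: ik => -[-> ->] [m mS]; rewrite /closes => cl;
  rewrite !(m, mS); congr phi; ring_from cl.
Qed.

End Chart.

(** Every panel contains one chamber of each label; mv i j c is the chamber
    labelled j in the panel of type i of c. *)
Record chamber_system (P : plane_data) := ChamberSystem {
  carrier :> Type;
  lab : carrier -> label P;
  mv : 'I_3 -> label P -> carrier -> carrier;
  lab_mv : forall i j c, lab (mv i j c) = j;
  mv_lab : forall i c, mv i (lab c) c = c;
  mv_mv : forall i j j' c, mv i j (mv i j' c) = mv i j c;
  charts : forall a c, exists2 phi, chart mv a phi & exists x, phi x (lab c) = c
}.

Lemma hexagon (P : plane_data) (C : chamber_system P) (c : C) i k u v j v' u' :
  i != k -> closes (plane i k) (lab c) u v j v' u' ->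
  mv i j (mv k v (mv i u c)) = mv k j (mv i v' (mv k u' c)).
Proof.
move=> ik cl; have [phi ch [x <-]] := charts (plane i k) c.
exact: (chart_hexagon x ch ik).
Qed.

Section ChartFromHexagons.
Context (P : plane_data) (C : Type) (lb : C -> label P)
  (mv : 'I_3 -> label P -> C -> C).
Context (lab_mv : forall i j c, lb (mv i j c) = j).
Context (mv_lab : forall i c, mv i (lb c) c = c).
Context (mv_mv : forall i j j' c, mv i j (mv i j' c) = mv i j c).

(** One chamber c at which all hexagons close determines a chart of its whole
    residue: each point x is the difference of two labels u and v, so it is
    reached from c by the gallery through u and v, and closing hexagons says that the line of a
    flag does not depend on the point used to reach it. *)
Lemma hexagon_chart a c :
  (forall u v j v' u', closes a (lb c) u v j v' u' ->
     lb c != u -> u != v -> v != j ->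
     mv a j (mv (a + 1) v (mv a u c)) =
     mv (a + 1) j (mv a v' (mv (a + 1) u' c))) ->
  exists2 phi, chart mv a phi & phi 0 (lb c) = c.
Proof.
move=> hx; pose k := (a + 1)%R.
have mv_id i j d : lb d = j -> mv i j d = d by move<-; exact: mv_lab.
have mv_same i i' j d : mv i j (mv i' j d) = mv i' j d.
  by rewrite mv_id ?lab_mv.
(* Degenerate hexagons close by the panel axioms: if two consecutive labels agree,
   the remaining four terms cancel in pairs. *)
have full u v j v' u' : closes a (lb c) u v j v' u' ->
    forall h, mv k h (mv a j (mv k v (mv a u c))) = mv k h (mv a v' (mv k u' c)).
  move=> cl h; case: (eqVneq (lb c) u) => [e1|n1].
    have /dlt_diff_cases : dlt a v - dlt a j = dlt a u' - dlt a v'.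
      by rewrite /closes e1 in cl; ring_from cl.
    case=> -[? ?]; subst.
      by rewrite (mv_id a (lb c)) // mv_same mv_mv mv_same mv_mv.
    by rewrite (mv_id a (lb c)).
  case: (eqVneq u v) => [e2|n2].
    have /dlt_diff_cases : dlt a (lb c) - dlt a j = dlt a u' - dlt a v'.
      by rewrite /closes e2 in cl; ring_from cl.
    rewrite e2 mv_same mv_mv; case=> -[? ?]; subst.
      by rewrite (mv_id a (lb c)) // mv_same mv_mv.
    by rewrite (mv_id k (lb c)).
  case: (eqVneq v j) => [e3|n3].
    have /dlt_diff_cases : dlt a (lb c) - dlt a u = dlt a u' - dlt a v'.
      by rewrite /closes e3 in cl; ring_from cl.
    rewrite -e3 mv_same mv_mv; case=> -[? ?]; subst.
      by rewrite eqxx in n1.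
    by rewrite (mv_id k (lb c)).
  by rewrite (hx _ _ _ _ _ cl n1 n2 n3) mv_mv.
pose phi x j := mv a j (mv k (dif a x).2 (mv a (dif a x).1 c)).
(* The right-hand side depends on the line x + dlt a j only. *)
have phiE x h j : mv k h (phi x j) =
    (let: (u, v) := dif a (dlt a (lb c) - (x + dlt a j)) in mv k h (mv a v (mv k u c))).
  case E : dif => [u v]; rewrite /phi; apply: full.
  have := difE a (dlt a (lb c) - (x + dlt a j)); rewrite E /= => {}E.
  by have := difE a x; rewrite /closes => E'; ring_from (congr2 +%R E E').
exists phi; last first.
  have /eqP := difE a (0 : coord P); rewrite subr_eq0 => /eqP/dlt_inj.
  by rewrite /phi => ->; rewrite mv_same mv_mv mv_lab.
split=> x j j'; first by rewrite /phi mv_mv.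
rewrite -[RHS](mv_id k j'); last by rewrite /phi lab_mv.
by rewrite !phiE (_ : x + dlt a j - dlt a j' + dlt a j' = x + dlt a j); last by ring.
Qed.

End ChartFromHexagons.

(** * Normal galleries *)
Section Directions.
Context (L : Type).
Implicit Types (y : seq ('I_3 * L)) (e f i k : 'I_3).

(** A gallery from the base chamber is the list of its steps, the last one
    first.  A step records which of the three coordinates of the tiling it
    changes and the label of the chamber reached; steps alternately decrease and
    increase their coordinate, starting with a decrease.  This function extracts
    the directions of every second step. *)
Fixpoint dirs (b : bool) y : seq 'I_3 :=
  if y is p :: y' then
    if b then p.1 :: dirs false y' else dirs true y'
  else [::].

(** The directions of the steps of the same sign as the last one.  The next step
    has the opposite sign, so it goes away from the base chamber exactly if its
    direction is not among them. *)
Definition used y := dirs true y.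
(** The directions of the steps of the same sign as the next one. *)
Definition pending y := dirs false y.

Arguments used : simpl never.
Arguments pending : simpl never.

Lemma used_cons e j y : used ((e, j) :: y) = e :: pending y.
Proof. by []. Qed.

Lemma pending_cons p y : pending (p :: y) = used y.
Proof. by []. Qed.

Definition dirsE := (used_cons, pending_cons).

(** The types of the three walls of a triangle of the tiling depend on the
    directions through an affine map of Z/3 with slope 1 or -1 according to
    the orientation of the triangle; this is its constant term. *)
Fixpoint turn y : 'I_3 :=
  if y is p :: y' then
    if odd (size y') then turn y' + p.1 else turn y' - p.1
  else 0.

Definition type_of y e : 'I_3 := if odd (size y) then turn y - e else turn y + e.
Definition dir_of y i : 'I_3 := if odd (size y) then turn y - i else i - turn y.

Lemma type_ofK y : cancel (type_of y) (dir_of y).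
Proof. by move=> e; rewrite /type_of /dir_of; case: odd; ring. Qed.

Lemma dir_ofK y : cancel (dir_of y) (type_of y).
Proof. by move=> e; rewrite /type_of /dir_of; case: odd; ring. Qed.

Lemma type_of_inj y : injective (type_of y).
Proof. exact: can_inj (type_ofK y). Qed.

Lemma type_of_cons y e j : type_of ((e, j) :: y) e = type_of y e.
Proof.
rewrite /type_of /=; case: odd => /=; case: (turn y) => [[|[|[|//]]] ?];
  case: e => [[|[|[|//]]] ?]; exact: val_inj.
Qed.

(** Around a vertex the types alternate while the directions run through all
    three values: the steps e, f, e' have the types i, k, i. *)
Lemma type_of_cons2 y e f j e' : uniq [:: e; f; e'] ->
  type_of ((e, j) :: y) f = type_of y e'.
Proof.
rewrite /type_of /=; case: odd => /=; case: (turn y) => [[|[|[|//]]] ?];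
  case: e => [[|[|[|//]]] ?]; case: f => [[|[|[|//]]] ?];
  case: e' => [[|[|[|//]]] ?] // _; exact: val_inj.
Qed.

Lemma type_of_cons3 y e f j v e' : uniq [:: e; f; e'] ->
  type_of ((f, v) :: (e, j) :: y) e' = type_of y e.
Proof.
move=> u; rewrite (@type_of_cons2 _ f e' v e) ?type_of_cons //.
by rewrite -(rot_uniq 1) in u.
Qed.

Lemma dir3 e f e' (u : uniq [:: e; f; e']) x : x \in [:: e; f; e'].
Proof.
move: u; case: e => [[|[|[|//]]] ?]; case: f => [[|[|[|//]]] ?];
  case: e' => [[|[|[|//]]] ?] //; by case: x => [[|[|[|//]]] ?].
Qed.

End Directions.

Section NormalForms.
Context (P : plane_data) (j0 : label P).
Notation gallery := (seq ('I_3 * label P)).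
Implicit Types (y r : gallery) (e f i k : 'I_3) (u v j l : label P).

Definition end_label y : label P := if y is p :: _ then p.2 else j0.

(** Normal galleries have no stutter, never use a direction with both signs, and
    have the directions of each sign sorted, with the smallest one last. *)
Fixpoint normal y : bool :=
  if y is p :: y' then
    [&& normal y', p.2 != end_label y', p.1 \notin used y'
      & all (fun e' => p.1 <= e')%N (pending y')]
  else true.

Definition plane_at y e f : 'I_3 := plane (type_of y e) (type_of y f).

(** Moving away from the base chamber in direction e.  If the last step of the
    same sign has a smaller direction e', the new step is exchanged with it
    around the vertex they share, and insertion continues below. *)
Fixpoint up e j y {struct y} : gallery :=
  if y is (f, v) :: (e', u) :: y2 then
    if (e' < e)%N then
      let h := hex (plane_at y2 e e') (end_label y2) u v j in
      (e', j) :: (f, h.2) :: up e h.1 y2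
    else (e, j) :: y
  else (e, j) :: y.

(** The inverse of up: the chamber nearest to the base in the panel crossed in
    direction e, where the most recent step in direction e is brought to the
    front by exchanges and then dropped. *)
Fixpoint down e y {struct y} : gallery :=
  if y is (e', j) :: y' then
    if e' == e then y' else
    if y' is (f, v) :: y2 then
      let r := down e y2 in
      let h := hex (plane_at r e e') (end_label r) (end_label y2) v j in
      (f, h.2) :: (e', h.1) :: r
    else y
  else [::].

Lemma gallery_ind2 (Q : gallery -> Prop) : Q [::] -> (forall p, Q [:: p]) ->
  (forall p p' y, Q y -> Q (p' :: y) -> Q (p :: p' :: y)) -> forall y, Q y.
Proof.
move=> Q0 Q1 Q2 y; suff [] : Q y /\ forall p, Q (p :: y) by [].
by elim: y => [|p y [IH1 IH2]]; split=> // p'; apply: Q2.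
Qed.

Lemma size_up e j y : size (up e j y) = (size y).+1.
Proof.
elim/gallery_ind2: y j => [|[f v]|[f v] [e' u] y IH _] j //=.
by case: ifP => //= _; rewrite IH.
Qed.

Lemma end_label_up e j y : end_label (up e j y) = j.
Proof. by case: y => [|[f v] [|[e' u] y]] //=; case: ifP. Qed.

Lemma turn_up e j y : turn (up e j y) = turn ((e, j) :: y).
Proof.
elim/gallery_ind2: y j => [|[f v]|[f v] [e' u] y IH _] j //=.
case: ifP => //= _; rewrite IH size_up /=; case: odd => /=; ring.
Qed.

(** Exchanges do not change the end of the gallery in the tiling. *)
Lemma type_of_up e j j' y : type_of (up e j y) =1 type_of ((e, j') :: y).
Proof. by move=> e'; rewrite /type_of size_up turn_up. Qed.

Lemma pending_up e j y : pending (up e j y) = used y.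
Proof.
elim/gallery_ind2: y j => [|[f v]|[f v] [e' u] y IH _] j //=.
by case: ifP => //= _; rewrite !dirsE IH.
Qed.

Lemma used_up e j y : used (up e j y) =i e :: pending y.
Proof.
elim/gallery_ind2: y j => [|[f v]|[f v] [e' u] y IH _] j //=.
by case: ifP => //= _ x; rewrite !dirsE !inE IH !inE orbCA.
Qed.

(** Without smaller directions of the same sign nothing is exchanged. *)
Lemma up_cons e j y : all (fun e' => e <= e')%N (pending y) -> up e j y = (e, j) :: y.
Proof.
case: y => [//|[f v] [//|[e1 u] y]]; rewrite !dirsE /= => /andP [le _].
by rewrite ltnNge le.
Qed.

Lemma used_pending_disjoint y e : normal y -> e \in used y -> e \notin pending y.
Proof.
elim: y e => [|[f j] y IH] e //= /and4P [n _ u _]; rewrite !dirsE inE.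
case/orP => [/eqP -> //|ep]; apply/negP => eu.
by have := IH e n eu; rewrite ep.
Qed.

Lemma normal_up e j y : normal y -> e \notin used y -> j != end_label y ->
  normal (up e j y).
Proof.
elim/gallery_ind2: y j => [|[f v]|[f v] [e' u] y IH _] j.
- by move=> _ _ /= ->.
- by rewrite /= => -> -> ->.
move=> n eu jl; rewrite /up -/up; case: ifP => [lt|/negbT]; last first.
  rewrite -leqNgt => le; apply/and4P; split=> //.
  move: n => /= /and4P [/and4P [_ _ _ al] _ _ _].
  by rewrite ?dirsE /= le; apply: sub_all al => x /(leq_trans le).
case h : hex => [u' v'] /=.
move: n eu jl => /= /and4P [/and4P [n ul e'u al] vu fu fal] eu jl.
rewrite eq_sym in ul; rewrite eq_sym in vu.
have [] := hex_nondegenerate ul vu _ h; first by rewrite eq_sym.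
move=> lu' u'v' v'j _.
move: fu eu; rewrite !dirsE !inE !negb_or => /andP [fe' fp] /andP [ef eu].
have {}IH : normal (up e u' y) by apply: IH => //; rewrite eq_sym.
apply/and4P; split; [apply/and4P; split|..] => //.
- by rewrite end_label_up eq_sym.
- by rewrite used_up inE negb_or eq_sym ef.
- by rewrite pending_up.
- by rewrite eq_sym.
- by rewrite eq_sym fe' pending_up.
- apply/allP => x; rewrite used_up inE => /orP [/eqP ->|].
    exact: ltnW.
  by move/(allP al).
Qed.

Record is_down y e (d : gallery) : Prop := IsDown {
  down_normal : normal d;
  down_ascent : e \notin used d;
  down_label : end_label d != end_label y;
  down_up : up e (end_label y) d = y
}.

Lemma downP y e : normal y -> e \in used y -> is_down y e (down e y).
Proof.
elim/gallery_ind2: y => [|[e' j]|[e' j] [f v] y IH _] //.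
  move=> /and4P [_ jl _ _]; rewrite dirsE inE => /eqP ->; rewrite /down eqxx.
  by split=> //; rewrite eq_sym.
move=> n eu; rewrite /down -/down; case: eqVneq => [ee|ne].
  subst; move: n => /= /and4P [n jl e'u al]; split=> //; first by rewrite eq_sym.
  by rewrite up_cons.
move: n eu => /= /and4P [/and4P [n vl fu fal] jv e'u al].
rewrite !dirsE inE eq_sym (negPf ne) /= => ey.
have [dn da dl du] := IH n ey; set r := down e y in dn da dl du *.
move: e'u; rewrite !dirsE inE negb_or => /andP [e'f e'p].
have py : pending y = used r by rewrite -du pending_up.
have uy : used y =i e :: pending r by move=> x; rewrite -du used_up.
rewrite eq_sym in vl; rewrite eq_sym in jv.
case h : hex => [a b] /=.
have [la ab bj h'] := hex_nondegenerate dl vl jv h.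
have e'e : (e' < e)%N.
  rewrite ltn_neqAle; apply/andP; split; first by rewrite val_eqE.
  by apply: (allP al); rewrite !dirsE.
have ue x : x \in pending r -> x \in used y by rewrite uy inE => ->; rewrite orbT.
have ef : e != f by apply: contraTneq ey => ->.
split=> /=; last 1 first.
- by rewrite e'e h' /= du.
- apply/and4P; split; first (apply/and4P; split=> //).
  + by rewrite eq_sym.
  + by rewrite -py.
  + by apply/allP => x /ue xu; apply: (allP al); rewrite !dirsE.
  + by rewrite eq_sym.
  + by rewrite dirsE inE negb_or eq_sym e'f; apply: contra fu; exact: ue.
  + by rewrite dirsE -py.
- by rewrite !dirsE inE negb_or ef.
- by [].
Qed.

Lemma upK y e j : normal y -> e \notin used y -> j != end_label y ->
  down e (up e j y) = y.
Proof.
elim/gallery_ind2: y j => [|[f v]|[f v] [e' u] y IH _] j.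
- by rewrite /= eqxx.
- by rewrite /= eqxx.
move=> n eu jl; rewrite /up -/up; case: ifP => [lt|_]; last by rewrite /= eqxx.
case h : hex => [u' v'] /=.
move: n eu jl => /= /and4P [/and4P [n ul e'u al] vu fu fal].
rewrite !dirsE !inE !negb_or => /andP [ef eu] jl.
rewrite eq_sym in ul; rewrite eq_sym in vu; rewrite eq_sym in jl.
have [lu' u'v' v'j h'] := hex_nondegenerate ul vu jl h.
case: eqVneq => [ee|_]; first by rewrite ee ltnn in lt.
by rewrite IH // 1?eq_sym // end_label_up h'.
Qed.

(** The chamber nearest to the base in the panel of y in direction e. *)
Definition near e y := if e \in used y then down e y else y.

Definition cross i j y :=
  let r := near (dir_of y i) y in
  if j == end_label r then r else up (dir_of y i) j r.

Lemma nearP e y : normal y ->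
  [/\ normal (near e y), e \notin used (near e y), type_of (near e y) e = type_of y e
    & y = if end_label y == end_label (near e y) then near e y
          else up e (end_label y) (near e y)].
Proof.
rewrite /near => n; case: ifP => [eu|/negbT eu]; last by rewrite eqxx.
have [dn da dl du] := downP n eu; split=> //; last first.
  by rewrite eq_sym (negPf dl) du.
by rewrite -{2}du (type_of_up _ _ (end_label y)) type_of_cons.
Qed.

Lemma near_id e y : e \notin used y -> near e y = y.
Proof. by rewrite /near => /negPf ->. Qed.

Lemma near_up e j y : normal y -> e \notin used y -> j != end_label y ->
  near e (up e j y) = y.
Proof.
by move=> n eu jl; rewrite /near used_up inE eqxx upK.
Qed.

Lemma cross_ascent e j r : e \notin used r ->
  cross (type_of r e) j r = if j == end_label r then r else up e j r.
Proof. by move=> er; rewrite /cross type_ofK near_id. Qed.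

Lemma cross_up e j j' r : normal r -> e \notin used r -> j' != end_label r ->
  cross (type_of r e) j (up e j' r) = if j == end_label r then r else up e j r.
Proof.
move=> n er jl; rewrite /cross.
have -> : dir_of (up e j' r) (type_of r e) = e.
  by rewrite -{1}(type_of_cons r e j') -(type_of_up _ j') type_ofK.
by rewrite near_up.
Qed.

Lemma normal_cross i j y : normal y -> normal (cross i j y).
Proof.
move=> n; have [nn na tn _] := nearP (dir_of y i) n.
by rewrite /cross; case: eqVneq => // jl; apply: normal_up.
Qed.

Lemma end_label_cross i j y : end_label (cross i j y) = j.
Proof. by rewrite /cross; case: eqVneq => // _; rewrite end_label_up. Qed.

Lemma cross_end_label i y : normal y -> cross i (end_label y) y = y.
Proof. by move=> n; have [_ _ _ e] := nearP (dir_of y i) n; rewrite /cross /= -e. Qed.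

Lemma cross_cross i j j' y : normal y -> cross i j (cross i j' y) = cross i j y.
Proof.
move=> n; rewrite {2}/cross [RHS]/cross; set e := dir_of y i.
have [nn na tn _] := nearP e n; rewrite dir_ofK in tn.
by case: eqVneq => [_|jl]; rewrite -{1}tn ?cross_ascent ?cross_up.
Qed.

Lemma size_down y e : normal y -> e \in used y -> (size (down e y)).+1 = size y.
Proof. by move=> n eu; have [_ _ _ du] := downP n eu; rewrite -{2}du size_up. Qed.

(** At a chamber y nearest to the base among those around a vertex, all
    hexagons close.  For e < e', inserting the last step of the gallery e, f, e'
    exchanges it with the first one; this turns the gallery into e', f, e with
    the labels given by hex, and e', f, e is inserted in this order. *)
Lemma cross_braid y e f e' u v j v' u' : normal y -> uniq [:: e; f; e'] ->
  e \notin used y -> e' \notin used y ->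
  closes (plane_at y e e') (end_label y) u v j v' u' ->
  end_label y != u -> u != v -> v != j ->
  cross (type_of y e) j (cross (type_of y e') v (cross (type_of y e) u y)) =
  cross (type_of y e') j (cross (type_of y e) v' (cross (type_of y e') u' y)).
Proof.
wlog : e e' u v v' u' / (e < e')%N.
  move=> hw n uq eu e'u cl lu uv vj.
  have /negPf ne : e != e' by apply: contraTneq uq => ->; rewrite /= !inE eqxx orbT.
  have [lt|] := ltnP e e'; first exact: hw.
  rewrite leq_eqVlt val_eqE eq_sym ne /= => lt.
  have [n1 n2 n3] := closes_nondegenerate cl lu uv vj.
  apply/esym/hw => //; rewrite 1?eq_sym //.
    by rewrite -rev_uniq.
  by rewrite /plane_at planeC; exact: closes_flip.
move=> lt n uq eu e'u cl lu uv vj.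
have [jv' v'u' u'l] := closes_nondegenerate cl lu uv vj.
(* As e and e' lead away from the base, only f can be used with the other sign. *)
have used_f x : x \in used y -> x = f.
  move=> xu; have := dir3 uq x; rewrite !inE => /or3P [] /eqP // ?; subst.
    by rewrite xu in eu.
  by rewrite xu in e'u.
have uq' : uniq [:: e'; f; e] by rewrite -rev_uniq.
have /and3P [] := uq; rewrite !inE negb_or => /andP [ef ee'] fe' _.
have fp : f \notin pending y.
  case: (y) n used_f => [|[g w] z] // n used_f.
  apply: used_pending_disjoint => //.
  by rewrite -(used_f g) // dirsE inE eqxx.
have pend x : x \in pending y -> x = e \/ x = e'.
  move=> xu; have := dir3 uq x; rewrite !inE => /or3P [] /eqP // ?; subst;
    by [left|right|rewrite xu in fp].
have upe : up e u y = (e, u) :: y.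
  by apply: up_cons; apply/allP => x /pend [] ->; rewrite // ltnW.
have upfc z w : pending z =i used y -> up f w z = (f, w) :: z.
  by move=> pz; apply: up_cons; apply/allP => x; rewrite pz => /used_f ->.
rewrite [cross _ u y]cross_ascent // [u == _]eq_sym (negPf lu) upe.
rewrite -{1}(@type_of_cons2 _ y e f u e') // cross_ascent; last first.
  by rewrite dirsE inE negb_or eq_sym ef.
rewrite [end_label ((e, u) :: y)]/= [v == _]eq_sym (negPf uv) upfc //.
rewrite -{1}(@type_of_cons3 _ y e f u v e') // cross_ascent; last first.
  rewrite !dirsE inE negb_or eq_sym fe'.
  by [].
rewrite /= [j == _]eq_sym (negPf vj) lt /plane_at planeC (hex_uniq cl) 1?eq_sym //=.
rewrite [cross _ u' y]cross_ascent // (negPf u'l).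
have t1 := @type_of_cons2 _ y e' f u' e uq'.
have t2 := @type_of_cons3 _ y e' f u' v' e uq'.
rewrite -{1}t1 -(type_of_up _ u') cross_ascent; last first.
  rewrite used_up inE negb_or fe' /=; exact: fp.
rewrite end_label_up (negPf v'u') upfc; last by rewrite pending_up.
have -> : type_of y e' = type_of ((f, v') :: up e' u' y) e.
  by rewrite -t2 /type_of /= size_up turn_up.
rewrite cross_ascent; last by rewrite dirsE inE negb_or ef pending_up.
rewrite (negPf jv' : (j == end_label ((f, v') :: _)) = false) [up e _ _]up_cons //.
rewrite dirsE; apply/allP => x; rewrite used_up inE.
by case/orP => [/eqP ->|/pend [] ->]; rewrite // ltnW.
Qed.

End NormalForms.

Section NormalFormSystem.
Context (P : plane_data) (j0 : label P).
Notation gallery := (seq ('I_3 * label P)).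

Definition nf := {y : gallery | normal j0 y}.

Definition nf_lab (c : nf) : label P := end_label j0 (val c).
Definition nf_mv i j (c : nf) : nf :=
  exist _ (cross j0 i j (val c)) (normal_cross i j (valP c)).

Lemma nf_lab_mv i j c : nf_lab (nf_mv i j c) = j.
Proof. exact: end_label_cross. Qed.

Lemma nf_mv_lab i c : nf_mv i (nf_lab c) c = c.
Proof. by apply: val_inj; apply: cross_end_label; exact: valP. Qed.

Lemma nf_mv_mv i j j' c : nf_mv i j (nf_mv i j' c) = nf_mv i j c.
Proof. by apply: val_inj; apply: cross_cross; exact: valP. Qed.

(** Distinct directions sum up with the third one to 0 in Z/3. *)
Lemma third_dir (e e' : 'I_3) : e != e' -> uniq [:: e; - (e + e'); e'].
Proof. by case: e => [[|[|[|//]]] ?]; case: e' => [[|[|[|//]]] ?]. Qed.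

Lemma size_near (y : gallery) (e : 'I_3) : normal j0 y -> e \in used y ->
  (size (near j0 e y) < size y)%N.
Proof. by move=> n eu; rewrite /near eu -(size_down n eu). Qed.

(** By induction on the distance from the base chamber.  If one of the two panels
    of c around the vertex has a nearer chamber, the chart there contains c;
    otherwise c is nearest among the chambers around the vertex and hexagons
    close at c. *)
Lemma nf_charts a c :
  exists2 phi, chart nf_mv a phi & exists x, phi x (nf_lab c) = c.
Proof.
have [n] := ubnP (size (val c)); elim: n c => // n IH c lec.
have descend i : dir_of (val c) i \in used (val c) ->
    exists2 d, nf_mv i (nf_lab c) d = c &
      exists2 phi, chart nf_mv a phi & exists x, phi x (nf_lab d) = d.
  move=> iu; have lt := size_near (valP c) iu.
  have [nn _ _ _] := nearP (dir_of (val c) i) (valP c).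
  pose d : nf := exist _ (near j0 (dir_of (val c) i) (val c)) nn.
  have dE : nf_mv i (nf_lab d) c = d.
    by apply: val_inj; rewrite /= /cross eqxx.
  exists d; first by rewrite -dE nf_mv_mv nf_mv_lab.
  by apply: IH; exact: leq_trans lt _.
have [u1|u1] := boolP (dir_of (val c) a \in used (val c)).
  have [d dE [phi ch [x xE]]] := descend _ u1; exists phi => //; exists x.
  by rewrite -(chart_mv ch _ (nf_lab d)) xE.
have [u2|u2] := boolP (dir_of (val c) (a + 1) \in used (val c)).
  have [d dE [phi ch [x xE]]] := descend _ u2; exists phi => //.
  exists (x + dlt a (nf_lab d) - dlt a (nf_lab c)).
  by rewrite -(chart_mvS ch) xE.
have [] := @hexagon_chart P nf nf_lab nf_mv nf_lab_mv nf_mv_lab nf_mv_mv a c.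
  move=> u v j v' u' cl lu uv vj; apply: val_inj => /=.
  set e := dir_of (val c) a in u1; set e' := dir_of (val c) (a + 1) in u2.
  have aE : type_of (val c) e = a by rewrite dir_ofK.
  have aE' : type_of (val c) e' = a + 1 by rewrite dir_ofK.
  have ee' : e != e'.
    by rewrite (can_eq (dir_ofK _)) -subr_eq0 opprD addrA subrr.
  rewrite -aE' -aE.
  apply: (cross_braid (valP c) (third_dir ee')) => //.
  by rewrite /plane_at aE aE' plane_succ.
by move=> phi ch e; exists phi => //; exists 0.
Qed.

Definition nf_system : chamber_system P :=
  ChamberSystem nf_lab_mv nf_mv_lab nf_mv_mv nf_charts.

Definition nf_base : nf_system := exist _ [::] isT.

(** * Following a normal gallery in another structure *)
Section Development.
Context (T : Type) (act : 'I_3 -> label P -> T -> T) (t0 : T).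

(** Reading a gallery from its first step on, as a sequence of operations on T
    indexed by the type and the label of each step. *)
Fixpoint develop (y : gallery) : T :=
  if y is p :: y' then act (type_of y' p.1) p.2 (develop y') else t0.

Context (act_hexagon : forall y i k u v j, i != k ->
  let h := hex (plane i k) (end_label j0 y) u v j in
  act i j (act k v (act i u (develop y))) =
  act k j (act i h.2 (act k h.1 (develop y)))).

(** Insertion changes a gallery only by exchanges of two steps, so whatever
    satisfies the exchange relation does not see the difference between inserting
    a step and appending it. *)
Lemma develop_up e j y : normal j0 y -> e \notin used y ->
  develop (up j0 e j y) = act (type_of y e) j (develop y).
Proof.
elim/gallery_ind2: y j => [|[f v]|[f v] [e' u] y IH _] j //.
move=> n eu; rewrite /up -/up; case: ifP => [lt|//].
move: n eu => /and4P [/and4P [n ul e'u al] vu fu fal].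
rewrite !dirsE !inE !negb_or => /andP [ef eu].
set h := hex _ _ _ _ _ => {al fal}; rewrite [LHS]/= [develop (_ :: _)]/= -/(up j0).
move: fu; rewrite dirsE inE negb_or => /andP [fe' fp].
have e'e : e' != e by apply: contraTneq lt => ->; rewrite ltnn.
have uq : uniq [:: e'; f; e].
  by rewrite /= !inE negb_or e'e [e' == f]eq_sym fe' [f == e]eq_sym ef.
have uq' : uniq [:: e; f; e'] by rewrite -rev_uniq.
have te f' : type_of (up j0 e h.1 y) f' = type_of ((e, u) :: y) f'.
  exact: type_of_up.
have te' : type_of ((f, h.2) :: up j0 e h.1 y) e' = type_of y e.
  by rewrite -(type_of_cons3 y u h.2 uq') /type_of /= size_up turn_up.
rewrite te' te IH // (type_of_cons2 _ _ uq) (type_of_cons3 _ _ _ uq).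
rewrite (type_of_cons2 _ _ uq'); apply/esym; rewrite /h /plane_at planeC.
by apply: act_hexagon; rewrite (inj_eq (@type_of_inj _ y)).
Qed.

End Development.

Section SystemDevelopment.
Context (C : chamber_system P) (c0 : C) (c0_lab : lab c0 = j0).

(** The normal galleries from j0 are universal: they map to every chamber
    system with a chamber labelled j0. *)
Definition chamber_at : gallery -> C := develop (@mv P C) c0.

Lemma lab_chamber_at y : lab (chamber_at y) = end_label j0 y.
Proof. by case: y => [|p y] //=; rewrite lab_mv. Qed.

Lemma chamber_at_up e j y : normal j0 y -> e \notin used y ->
  chamber_at (up j0 e j y) = mv (type_of y e) j (chamber_at y).
Proof.
apply: develop_up => {}y i k u v {}j ik; apply: hexagon => //.
by rewrite lab_chamber_at; exact: hex_closes.
Qed.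

Lemma chamber_at_cross i j y : normal j0 y ->
  chamber_at (cross j0 i j y) = mv i j (chamber_at y).
Proof.
move=> n; have [nn na tn yE] := nearP (dir_of y i) n.
rewrite dir_ofK in tn; rewrite /cross; move: nn na tn yE.
set r := near _ _ _; set e := dir_of y i => nn na tn yE.
have -> : chamber_at y = mv i (end_label j0 y) (chamber_at r).
  rewrite {1}yE; case: eqVneq => [->|_]; first by rewrite -lab_chamber_at mv_lab.
  by rewrite chamber_at_up ?tn.
rewrite mv_mv; case: eqVneq => [->|_]; first by rewrite -lab_chamber_at mv_lab.
by rewrite chamber_at_up ?tn.
Qed.

End SystemDevelopment.
End NormalFormSystem.

(** * The apartment and lengths in the Coxeter group *)
Section Thin.

Definition thin_dif (x : 'Z_3) : bool * bool :=
  if x == 1 then (true, false) else if x == 2 then (false, true) else (false, false).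

Lemma thin_difE (a : 'I_3) (x : 'Z_3) :
  (thin_dif x).1%:R - (thin_dif x).2%:R = x.
Proof. by case: x => [[|[|[|//]]] ?]; exact: val_inj. Qed.

Lemma thin_diff_inj (a : 'I_3) (u v u' v' : bool) :
  u%:R - v%:R = u'%:R - v'%:R :> 'Z_3 -> u != v -> u = u' /\ v = v'.
Proof. by case: u; case: v; case: u'; case: v'. Qed.

(** The plane of order 1, a triangle: {0, 1} is a perfect difference set
    in Z/3.  Its normal galleries are the triangles of the tiling. *)
Definition thin : plane_data :=
  @PlaneData 'Z_3 bool (fun _ b => b%:R) (fun=> thin_dif) thin_difE thin_diff_inj.

Definition apartment : chamber_system thin := nf_system (false : label thin).

Definition flip i (c : apartment) : apartment :=
  mv i (~~ (lab c : bool) : label thin) c.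

Lemma flipK i : involutive (flip i).
Proof. by move=> c; rewrite /flip lab_mv negbK mv_mv mv_lab. Qed.

(** With two labels a gallery without stutter alternates them, and the alternating
    sum around a vertex is then 3 times a difference, which is 0 in Z/3. *)
Lemma flip_braid i k c : i != k ->
  flip i (flip k (flip i c)) = flip k (flip i (flip k c)).
Proof.
move=> ik; rewrite /flip !lab_mv !negbK; apply: hexagon => //.
by rewrite /closes; move: (lab c : bool) => [] /=; apply/eqP.
Qed.

(** Signs of letters do not matter, as every flip is an involution. *)
Definition walk (c : apartment) (w : word 'I_3) : apartment :=
  foldl (fun c x => flip x.1 c) c w.

Lemma walk_cat c v w : walk c (v ++ w) = walk (walk c v) w.
Proof. exact: foldl_cat. Qed.

Lemma walk_word_eq v w : word_eq (cox_relator A2_tilde) v w ->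
  forall c, walk c v = walk c w.
Proof.
elim=> // {v w}.
- by move=> u v w _ IH1 _ IH2 c; rewrite IH1.
- by move=> v v' w w' _ IH1 _ IH2 c; rewrite !walk_cat IH1 IH2.
- by move=> i b c; rewrite /walk /= flipK.
move=> _ [i [k [_ ->]]] c; rewrite /= /A2_tilde_m.
case: eqVneq => [->|ik]; rewrite /walk /= ?flipK //.
by rewrite [flip i (flip k (flip i c))]flip_braid // !flipK.
Qed.

Lemma size_flip i c : (size (val (flip i c)) <= (size (val c)).+1)%N.
Proof.
rewrite /flip /= /cross; set e := dir_of _ _.
have le : (size (near (false : label thin) e (val c)) <= size (val c))%N.
  rewrite /near; case: ifP => // eu.
  have := size_down (valP c) eu.
  by move=> <-; rewrite leqnSn.
case: ifP => _; first exact: leqW.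
by rewrite (size_up (P := thin)) ltnS.
Qed.

Lemma size_walk c w : (size (val (walk c w)) <= size (val c) + size w)%N.
Proof.
elim: w c => [|x w IH] c /=; first by rewrite addn0.
by apply: leq_trans (IH _) _; rewrite addnS -addSn leq_add2r size_flip.
Qed.

End Thin.

Local Notation W := (coxeter_group A2_tilde).
Local Notation s_ i := (cox_gen A2_tilde i).

Lemma cox_gen_sq i : (s_ i * s_ i = 1)%g.
Proof.
have -> : (s_ i * s_ i)%g = cox_word A2_tilde [:: i; i].
  by rewrite /cox_word !big_cons big_nil mulg1.
rewrite cox_wordE; apply/wclassP/word_eq_rel; exists i, i.
by rewrite /= A2_tilde_diag.
Qed.

Lemma cox_gen_inv i : ((s_ i)^-1 = s_ i)%g.
Proof. by apply: (mulgI (s_ i)); rewrite mulgV cox_gen_sq. Qed.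

Lemma cox_gen_braid i k : i != k ->
  (s_ i * s_ k * s_ i = s_ k * s_ i * s_ k)%g.
Proof.
move=> ik; have e : cox_word A2_tilde [:: i; k; i; k; i; k] = 1%g.
  rewrite cox_wordE; apply/wclassP/word_eq_rel; exists i, k.
  by rewrite /= /A2_tilde_m (negPf ik).
move: e; rewrite /cox_word !big_cons big_nil mulg1 !mulgA => e.
apply: (mulIg (s_ k)); apply: (mulIg (s_ i)); apply: (mulIg (s_ k)).
rewrite e -!mulgA [(s_ k * (s_ k * _))%g]mulgA cox_gen_sq mul1g.
rewrite [(s_ i * (s_ i * _))%g]mulgA cox_gen_sq mul1g cox_gen_sq.
by [].
Qed.

Lemma cox_word_cons i s : cox_word A2_tilde (i :: s) = (s_ i * cox_word A2_tilde s)%g.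
Proof. by rewrite /cox_word big_cons. Qed.

Lemma cox_word_rcons s i :
  cox_word A2_tilde (rcons s i) = (cox_word A2_tilde s * s_ i)%g.
Proof. by rewrite /cox_word big_rcons. Qed.

Lemma cox_word_rev s : cox_word A2_tilde (rev s) = (cox_word A2_tilde s)^-1%g.
Proof.
elim: s => [|i s IH]; first by rewrite /cox_word big_nil invg1.
by rewrite rev_cons cox_word_rcons IH cox_word_cons invMg cox_gen_inv.
Qed.

Lemma cox_length_le s : (cox_length (cox_word A2_tilde s) <= size s)%N.
Proof.
rewrite /cox_length; case: ex_minnP => m _; apply.
by apply/boolp.asboolP; exists s.
Qed.

Lemma cox_length_word (w : W) :
  exists2 s, cox_word A2_tilde s = w & size s = cox_length w.
Proof.
rewrite /cox_length; case: ex_minnP => m /boolp.asboolP [s [<- <-]] _.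
by exists s.
Qed.

Lemma cox_length_inv (w : W) : cox_length (w^-1)%g = cox_length w.
Proof.
suff le (v : W) : (cox_length (v^-1)%g <= cox_length v)%N.
  by apply/eqP; rewrite eqn_leq le -{1}[w]invgK le.
have [s <- <-] := cox_length_word v.
by rewrite -cox_word_rev -size_rev cox_length_le.
Qed.

Lemma cox_length_mul_gen (w : W) i :
  (cox_length (w * s_ i)%g <= (cox_length w).+1)%N.
Proof.
have [s <- <-] := cox_length_word w.
by rewrite -cox_word_rcons -(size_rcons s i) cox_length_le.
Qed.

(** * Weyl elements of normal galleries *)
Section WeylElement.
Context (P : plane_data) (j0 : label P).
Notation gallery := (seq ('I_3 * label P)).
Implicit Types (y : gallery) (e : 'I_3).

Definition weyl : gallery -> W := develop (fun i (_ : label P) w => w * s_ i)%g 1%g.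

Lemma weyl_up e j y : normal j0 y -> e \notin used y ->
  weyl (up j0 e j y) = (weyl y * s_ (type_of y e))%g.
Proof.
move=> n eu; rewrite /weyl (develop_up _ _ n eu) // => z i k _ _ _ ik /=.
by rewrite -!mulgA !(mulgA (s_ _)) cox_gen_braid.
Qed.

Fixpoint types y : seq 'I_3 :=
  if y is p :: y' then rcons (types y') (type_of y' p.1) else [::].

Lemma weylE y : weyl y = cox_word A2_tilde (types y).
Proof.
elim: y => [|p y IH]; first by rewrite /cox_word big_nil.
by rewrite /= /weyl /= -/(weyl y) IH /cox_word big_rcons.
Qed.

Lemma size_types y : size (types y) = size y.
Proof. by elim: y => //= p y IH; rewrite size_rcons IH. Qed.

(** The shape of a gallery, its list of directions, determines all that does not
    involve labels; so normal galleries can be compared with galleries in the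
    apartment. *)
Lemma dirs_shape (L L' : Type) (z : seq ('I_3 * L)) (z' : seq ('I_3 * L')) b :
  map fst z = map fst z' -> dirs b z = dirs b z'.
Proof.
elim: z z' b => [|p z IH] [|p' z'] //= b [-> e].
by case: b; rewrite (IH z').
Qed.

Lemma type_shape (L L' : Type) (z : seq ('I_3 * L)) (z' : seq ('I_3 * L')) :
  map fst z = map fst z' -> type_of z =1 type_of z'.
Proof.
move=> ez e; have sz : size z = size z' by rewrite -(size_map fst) ez size_map.
rewrite /type_of sz; suff -> : turn z = turn z' by [].
elim: z z' ez {sz} => [|p z IH] [|p' z'] //= [-> ez].
by rewrite (IH _ ez) -(size_map fst z) ez size_map.
Qed.

(** Walking in the apartment along the types of a normal gallery inserts each of
    its steps without any exchange. *)
Lemma walk_types y : normal j0 y ->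
  map fst (val (walk (nf_base (false : label thin)) [seq (i, true) | i <- types y]))
  = map fst y.
Proof.
elim: y => [|[e j] y IH] //= /and4P [n _ eu al].
rewrite map_rcons -cats1 walk_cat; set c := walk _ _ in IH *.
have {}IH := IH n; rewrite /= -(type_shape IH).
rewrite -IH; have ec : used (val c) = used y := dirs_shape true IH.
have pc : pending (val c) = pending y := dirs_shape false IH.
rewrite cross_ascent ?ec //; case: eqVneq => [|_].
  have neg (b : bool) : ~~ b <> b by case: b.
  by move/neg.
by rewrite up_cons ?pc.
Qed.

(** A word for the Weyl element of y ends, in the apartment, at a chamber with
    as many steps as y, and each letter adds at most one step. *)
Lemma weyl_length y : normal j0 y -> cox_length (weyl y) = size y.
Proof.
move=> n; rewrite /cox_length; case: ex_minnP => m /boolp.asboolP [s [sm sE]] min.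
apply/eqP; rewrite eqn_leq; apply/andP; split.
  apply: min; apply/boolp.asboolP; exists (types y).
  by rewrite size_types weylE.
move: sE; rewrite weylE !cox_wordE => /wclassP/walk_word_eq.
move=> /(_ (nf_base (false : label thin))) e.
rewrite -(size_map fst y) -walk_types // -e -sm size_map.
by apply: leq_trans (size_walk _ _) _; rewrite /= size_map.
Qed.

Lemma weyl_cross i j y : normal j0 y ->
  weyl (cross j0 i j y) = weyl y \/ weyl (cross j0 i j y) = (weyl y * s_ i)%g.
Proof.
move=> n; have [nn na tn yE] := nearP (dir_of y i) n; rewrite dir_ofK in tn.
rewrite /cross; set r := near _ _ _ in nn na tn yE *.
set e := dir_of y i in nn na tn yE *.
have [yw|yw] : weyl y = weyl r \/ weyl y = (weyl r * s_ i)%g.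
- by rewrite yE; case: ifP => _; [left|right; rewrite weyl_up ?tn].
- by rewrite yw; case: ifP => _; [left|right; rewrite weyl_up ?tn].
rewrite yw -mulgA cox_gen_sq mulg1.
by case: ifP => _; [right|left; rewrite weyl_up ?tn].
Qed.

(** If the panel of y has a nearer chamber, the product by the generator is the
    Weyl element of that chamber and is shorter. *)
Lemma weyl_cross_longer i j y : normal j0 y -> j != end_label j0 y ->
  cox_length (weyl y * s_ i)%g = (size y).+1 ->
  weyl (cross j0 i j y) = (weyl y * s_ i)%g.
Proof.
move=> n jy; have [eu|eu] := boolP (dir_of y i \in used y); last first.
  move=> _; rewrite -{1}(dir_ofK y i) cross_ascent // (negPf jy).
  by rewrite weyl_up // dir_ofK.
have [nn na tn yE] := nearP (dir_of y i) n; rewrite dir_ofK in tn.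
have [dn da dl du] := downP n eu.
have sz := size_down n eu.
have -> : weyl y = (weyl (down j0 (dir_of y i) y) * s_ i)%g.
  by rewrite /near eu in tn; rewrite -{1}du weyl_up // tn.
by rewrite -mulgA cox_gen_sq mulg1 weyl_length // -sz; lia.
Qed.

Lemma exists_weyl_cross i y : normal j0 y -> (forall j : label P, exists j', j' != j) ->
  exists2 j, j != end_label j0 y & weyl (cross j0 i j y) = (weyl y * s_ i)%g.
Proof.
move=> n other; have [eu|eu] := boolP (dir_of y i \in used y); last first.
  have [j jy] := other (end_label j0 y); exists j => //.
  by rewrite -{1}(dir_ofK y i) cross_ascent // (negPf jy) weyl_up // dir_ofK.
have [_ _ tn _] := nearP (dir_of y i) n; rewrite dir_ofK /near eu in tn.
have [dn da dl du] := downP n eu; exists (end_label j0 (down j0 (dir_of y i) y)) => //.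
rewrite /cross /near eu eqxx.
have -> : weyl y = (weyl (down j0 (dir_of y i) y) * s_ i)%g.
  by rewrite -{1}du weyl_up // tn.
by rewrite -mulgA cox_gen_sq mulg1.
Qed.

End WeylElement.

(** * Galleries without stutter *)
Section Galleries.
Context (P : plane_data) (C : chamber_system P).

Fixpoint joined (s : seq 'I_3) (c d : C) : Prop :=
  if s is i :: s' then exists2 j : label P, j != lab c & joined s' (mv i j c) d
  else c = d.

Lemma joined_cat s1 s2 c d :
  joined (s1 ++ s2) c d <-> exists2 e, joined s1 c e & joined s2 e d.
Proof.
elim: s1 c => [|i s1 IH] c /=.
  by split=> [|[e <-]] //; exists c.
split=> [[j jc /IH [e p1 p2]]|[e [j jc p1] p2]].
  by exists e => //; exists j.
by exists j => //; apply/IH; exists e.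
Qed.

Lemma joined_rev s c d : joined s c d -> joined (rev s) d c.
Proof.
elim: s c => [|i s IH] c //= [j jc /IH p]; rewrite rev_cons -cats1.
apply/joined_cat; exists (mv i j c) => //; exists (lab c).
  by rewrite lab_mv eq_sym.
by rewrite mv_mv mv_lab.
Qed.

End Galleries.

(** * The chamber system of the group Gamma *)
Lemma singer_order_gt1 q : (0 < q)%N -> (1 < singer_order q)%N.
Proof. by rewrite /singer_order; case: q => // n _; rewrite addn1 ltnS addnS. Qed.

Section GammaSystem.
Context (q : nat) (delta : 'I_3 -> 'I_q.+1 -> 'Z_(singer_order q)).
Context (q_gt0 : (0 < q)%N) (delta0 : forall a, delta a ord0 = 0).
Context (dif : 'I_3 -> 'Z_(singer_order q) -> 'I_q.+1 * 'I_q.+1)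
  (difE : forall a x, delta a (dif a x).1 - delta a (dif a x).2 = x)
  (delta_diff_inj : forall a u v u' v',
     delta a u - delta a v = delta a u' - delta a v' ->
     u != v -> u = u' /\ v = v').

Notation N := (singer_order q).
Notation R := (Gamma_relator delta).
Notation G := (Gamma delta).

Definition singer_planes : plane_data :=
  @PlaneData 'Z_N 'I_q.+1 delta dif difE delta_diff_inj.
Notation PG := singer_planes.

Let N_gt1 : (1 < N)%N := singer_order_gt1 q_gt0.

Definition sigma a (x : 'Z_N) : G := (gen R a ^+ x)%g.

Lemma wclass_cat v w : wclass R (v ++ w) = (wclass R v * wclass R w)%g.
Proof. exact/esym/wclassM. Qed.

Lemma wclass_sigma a n : wclass R (sigma_pow a n) = (gen R a ^+ n)%g.
Proof.
elim: n => [|n IH]; first by rewrite expg0.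
by rewrite expgS -IH; exact: (wclass_cat [:: (a, true)]).
Qed.

Lemma gen_order a : (gen R a ^+ N)%g = 1%g.
Proof. by rewrite -wclass_sigma; apply/wclassP/word_eq_rel; left; exists a. Qed.

Lemma gen_mod a n : (gen R a ^+ (n %% N))%g = (gen R a ^+ n)%g.
Proof.
rewrite [in RHS](divn_eq n N) expgnDr mulnC expgnA gen_order expg1n.
by rewrite mul1g.
Qed.

Lemma sigma_nat a n : sigma a n%:R = (gen R a ^+ n)%g.
Proof. by rewrite /sigma val_Zp_nat ?gen_mod // N_gt1. Qed.

Lemma sigmaD a x y : sigma a (x + y) = (sigma a x * sigma a y)%g.
Proof.
by rewrite -{1}(natr_Zp x) -{1}(natr_Zp y) -natrD sigma_nat expgnDr.
Qed.

Lemma sigma0 a : sigma a 0 = 1%g.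
Proof. by rewrite /sigma expg0. Qed.

Lemma sigmaN a x : sigma a (- x) = (sigma a x)^-1%g.
Proof. by apply: (mulgI (sigma a x)); rewrite -sigmaD subrr sigma0 mulgV. Qed.

Lemma sigma1 a : sigma a 1 = gen R a.
Proof. by rewrite (sigma_nat a 1) expg1. Qed.

Lemma genV a : wclass R [:: (a, false)] = (gen R a)^-1%g.
Proof.
apply: (mulgI (gen R a)); rewrite mulgV.
rewrite -[LHS](wclass_cat [:: (a, true)] [:: (a, false)]); apply/wclassP.
exact: (word_eq_cancel _ a true).
Qed.

Lemma triangle_relation j :
  (sigma 0%R (delta 0%R j) * sigma 1%R (delta 1%R j) *
   sigma 2%R (delta 2%R j) = 1)%g.
Proof.
rewrite /sigma -!wclass_sigma -mulgA -(wclass_cat (sigma_pow 1 _)) -wclass_cat.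
by apply/wclassP/word_eq_rel; right; exists j.
Qed.

(** The panel of type i of the chamber (g, j) is g * panel_pos i j. *)
Definition panel_pos (i : 'I_3) (j : 'I_q.+1) : G :=
  match val i with
  | 0%N => 1%g
  | 1%N => sigma 0 (delta 0 j)
  | _ => (sigma 0%R (delta 0%R j) * sigma 1%R (delta 1%R j))%g
  end.

(** Consecutive panels differ by a power of the generator fixing their common
    vertex; for a = 2 this is the relation indexed by j. *)
Lemma panel_posS a j :
  panel_pos (a + 1) j = (panel_pos a j * sigma a (delta a j))%g.
Proof.
case: a => [[|[|[|//]]] ia]; rewrite /panel_pos /=.
- by rewrite mul1g (_ : Ordinal ia = 0) //; exact: val_inj.
- by rewrite (_ : Ordinal ia = 1) //; exact: val_inj.
- by rewrite (_ : Ordinal ia = 2) ?triangle_relation //; exact: val_inj.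
Qed.

Lemma panel_pos0 i : panel_pos i ord0 = 1%g.
Proof.
by case: i => [[|[|i]] ?]; rewrite /panel_pos /= ?delta0 ?sigma0 ?mulg1.
Qed.

Definition gamma_chamber : Type := (G * 'I_q.+1)%type.

Definition gamma_mv i j' (c : gamma_chamber) : gamma_chamber :=
  ((c.1 * panel_pos i c.2 * (panel_pos i j')^-1)%g, j').

Lemma gamma_lab_mv i j (c : gamma_chamber) : (gamma_mv i j c).2 = j.
Proof. by []. Qed.

Lemma gamma_mv_lab i (c : gamma_chamber) : gamma_mv i c.2 c = c.
Proof. by case: c => g j; rewrite /gamma_mv /= mulgK. Qed.

Lemma gamma_mv_mv i j j' (c : gamma_chamber) :
  gamma_mv i j (gamma_mv i j' c) = gamma_mv i j c.
Proof. by rewrite /gamma_mv /= mulgVK. Qed.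

(** The chambers around the vertex of type a of c, with panels in a left coset of
    the cyclic group of sigma a. *)
Lemma gamma_charts a (c : gamma_chamber) :
  exists2 phi : coord PG -> label PG -> gamma_chamber,
    chart (P := PG) gamma_mv a phi & exists x, phi x c.2 = c.
Proof.
pose h := (c.1 * panel_pos a c.2)%g.
exists (fun x j => (h * sigma a x * (panel_pos a j)^-1, j)%g); last first.
  by exists 0; rewrite sigma0 mulg1 mulgK -surjective_pairing.
split=> x j j'; rewrite /gamma_mv /= ?mulgVK //.
by congr pair; rewrite !panel_posS invMg -sigmaN !mulgA mulgVK !sigmaD !mulgA.
Qed.

Definition gamma_system : chamber_system PG :=
  @ChamberSystem PG gamma_chamber snd gamma_mv gamma_lab_mv gamma_mv_lab
    gamma_mv_mv gamma_charts.

Notation X := gamma_system.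

(** * Universality of the chamber system of Gamma *)
Section Steps.
Context (C : chamber_system PG).
Implicit Types (c : C) (a : 'I_3) (x y : 'Z_N).

(** The action of sigma a ^ x on chambers labelled ord0.  All three panels of
    (g, ord0) are labelled by g, as delta _ ord0 = 0, so these chambers stand for
    the elements of Gamma; one crosses two panels with labels whose difference
    is x to get from g to g * sigma a x. *)
Definition step a x c : C :=
  mv a (ord0 : label PG)
    (mv (a + 1) ((dif a x).2 : label PG) (mv a ((dif a x).1 : label PG) c)).

Lemma lab_step a x c : lab (step a x c) = ord0.
Proof. exact: lab_mv. Qed.

Lemma chart_step a phi x y j : chart (@mv PG C) a phi ->
  step a x (phi y j) = phi (y + x) ord0.
Proof.
move=> [m mS]; rewrite /step m mS m.
by congr phi; rewrite -addrA /= difE.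
Qed.

Lemma step0 a c : lab c = ord0 -> step a 0 c = c.
Proof.
move=> l0; have [phi ch [x xE]] := charts a c.
by rewrite -xE (chart_step _ _ _ ch) addr0 l0.
Qed.

Lemma stepD a x y c : step a y (step a x c) = step a (x + y) c.
Proof.
have [phi ch [z <-]] := charts a c.
by rewrite !(chart_step _ _ _ ch) addrA.
Qed.

(** For x in the difference set one intermediate chamber is enough. *)
Lemma step_delta a j c : lab c = ord0 ->
  step a (delta a j) c = mv (a + 1) (ord0 : label PG) (mv a (j : label PG) c).
Proof.
move=> l0; have [phi ch [x xE]] := charts a c.
rewrite -xE (chart_step _ _ _ ch) (chart_mv ch) (chart_mvS ch).
by rewrite /= delta0 subr0.
Qed.

Definition steps (w : word 'I_3) c : C :=
  foldl (fun c p => step p.1 (if p.2 then 1 else -1) c) c w.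

Lemma steps_cons p w c :
  steps (p :: w) c = steps w (step p.1 (if p.2 then 1 else -1) c).
Proof. by []. Qed.

Lemma steps_cat v w c : steps (v ++ w) c = steps w (steps v c).
Proof. exact: foldl_cat. Qed.

Lemma lab_steps w c : lab c = ord0 -> lab (steps w c) = ord0.
Proof.
elim: w c => [|p w IH] c // _ /=; apply: IH; exact: lab_step.
Qed.

Lemma steps_sigma a n c : lab c = ord0 -> steps (sigma_pow a n) c = step a n%:R c.
Proof.
elim: n c => [|n IH] c l0; first by rewrite step0.
by rewrite /= IH ?lab_step // stepD -natr1 addrC.
Qed.

(** A power of a generator moves a chamber inside the residue at a vertex, so
    steps add up in a chart.  The relation indexed by j acts trivially since its
    three factors move from panel to panel of a single chamber labelled j. *)
Lemma steps_word_eq v w : word_eq R v w ->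
  forall c, lab c = ord0 -> steps v c = steps w c.
Proof.
elim=> // {v w}.
- by move=> v w _ IH c l0; rewrite IH.
- by move=> u v w _ IH1 _ IH2 c l0; rewrite IH1 // IH2.
- move=> v v' w w' _ IH1 _ IH2 c l0.
  by rewrite !steps_cat IH1 // IH2 // lab_steps.
- by move=> i [] c l0; rewrite /= stepD ?subrr ?addNr step0.
move=> r [[a ->]|[j ->]] c l0.
  rewrite steps_sigma // (_ : N%:R = 0) ?step0 //.
  by apply: val_inj; rewrite /= val_Zp_nat ?modnn // N_gt1.
rewrite !steps_cat !steps_sigma ?lab_step // !natr_Zp.
rewrite !step_delta ?lab_mv //.
set d := mv 0 _ c; have ld : lab d = j by exact: lab_mv.
have mv_j i : mv i (j : label PG) (mv i (ord0 : label PG) d) = d.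
  by rewrite mv_mv -{1}ld mv_lab.
have -> : 2 + 1 = 0 :> 'I_3 by exact: val_inj.
rewrite add0r mv_j (_ : 1 + 1 = 2) ?mv_j; last exact: val_inj.
by rewrite /d mv_mv -l0 mv_lab.
Qed.

Context (c0 : C).

(** Going to the chamber labelled ord0 in the panel of type 0 of c0, from where
    g acts by steps. *)
Definition place_zero (g : G) : C :=
  steps (repr (g : {eq_quot word_equiv R})) (mv 0 (ord0 : label PG) c0).

Definition place (x : X) : C := mv 0 (lab x) (place_zero x.1).

Lemma place_zero_wclass w :
  place_zero (wclass R w) = steps w (mv 0 (ord0 : label PG) c0).
Proof. by apply: steps_word_eq; [exact: repr_wclass|exact: lab_mv]. Qed.

Lemma lab_place_zero g : lab (place_zero g) = ord0.
Proof. by apply: lab_steps; exact: lab_mv. Qed.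

Lemma place_zeroM g a x : place_zero (g * sigma a x)%g = step a x (place_zero g).
Proof.
have [w ->] := wclass_surj g; rewrite /sigma -wclass_sigma.
rewrite -wclass_cat !place_zero_wclass steps_cat steps_sigma ?natr_Zp //.
by apply: lab_steps; exact: lab_mv.
Qed.

(** The panel of type 0 is shared by all the chambers (g, j) with the same g; the
    panels of types 1 and 2 are compared with it in the charts of the
    vertices of types 0 and 2. *)
Lemma place_mv i j (x : X) : place (mv i j x) = mv i j (place x).
Proof.
case: x => g j0; rewrite /place /= -mulgA.
case: i => [[|[|[|//]]] ii].
- by rewrite /panel_pos /= mulgV mulg1 (_ : Ordinal ii = 0) ?mv_mv //; exact: val_inj.
- rewrite /panel_pos /= -sigmaN -sigmaD place_zeroM.
  have [phi ch [x xE]] := charts 0 (place_zero g).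
  rewrite -xE (chart_step _ _ _ ch) !(chart_mv ch).
  by rewrite (_ : Ordinal ii = 0 + 1) ?(chart_mvS ch) ?addrA //; exact: val_inj.
have E j' : panel_pos (Ordinal ii) j' = sigma 2 (- delta 2 j').
  apply: (mulIg (sigma 2 (delta 2 j'))); rewrite -sigmaD addNr sigma0.
  rewrite (_ : Ordinal ii = 2) -?panel_posS //; exact: val_inj.
rewrite !E -sigmaN opprK -sigmaD place_zeroM.
have [phi ch [x xE]] := charts 2 (place_zero g).
have z3 : 2 + 1 = 0 :> 'I_3 by exact: val_inj.
have mS := chart_mvS ch; rewrite z3 in mS.
rewrite -xE (chart_step _ _ _ ch) !mS lab_place_zero /= !delta0.
rewrite (_ : Ordinal ii = 2) ?(chart_mv ch); last exact: val_inj.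
congr phi; ring.
Qed.

Lemma place_base : place ((1%g, lab c0) : gamma_chamber) = c0.
Proof. by rewrite /place /= (place_zero_wclass [::]) /= mv_mv mv_lab. Qed.

End Steps.

Lemma gamma_step a x g :
  step a x ((g, ord0) : X) = ((g * sigma a x)%g, ord0) :> gamma_chamber.
Proof.
rewrite /step /= /gamma_mv /= !panel_pos0 invg1 !mulg1.
rewrite !panel_posS invMg -!sigmaN !mulgA !mulgVK -mulgA -sigmaD.
by rewrite difE.
Qed.

Lemma gamma_steps w g :
  steps w ((g, ord0) : X) = ((g * wclass R w)%g, ord0) :> gamma_chamber.
Proof.
elim: w g => [|[a b] w IH] g; first by rewrite (_ : wclass R [::] = 1%g) // mulg1.
rewrite steps_cons gamma_step IH -mulgA; congr (_ * _, _)%g.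
rewrite -[(a, b) :: w]cat1s wclass_cat; congr (_ * _)%g.
by case: b; rewrite ?sigmaN sigma1 ?genV.
Qed.

Lemma morph_steps (C D : chamber_system PG) (f : C -> D) :
  (forall i j c, f (mv i j c) = mv i j (f c)) ->
  forall w c, f (steps w c) = steps w (f c).
Proof.
by move=> fmv; elim=> [|p w IH] c //=; rewrite IH /step !fmv.
Qed.

(** * The Weyl distance *)
Notation nf j0 := (nf_system (P := PG) j0).

(** The normal gallery from C to D, after moving C to the identity element. *)
Definition position (C D : X) : nf (lab C) :=
  place (nf_base (P := PG) (lab C)) ((C.1^-1 * D.1)%g, D.2).

Lemma lab_position C D : lab (position C D) = lab D.
Proof. exact: lab_mv. Qed.

Lemma position_mv C i j D : position C (mv i j D) = mv i j (position C D).
Proof. by rewrite /position -place_mv /= /gamma_mv /= !mulgA. Qed.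

Lemma position_self C : position C C = nf_base (P := PG) (lab C).
Proof. by rewrite /position mulVg; exact: place_base. Qed.

(** Both maps commute with crossing panels, and every chamber is reached from C by
    crossing panels, as the generators of Gamma act by steps. *)
Lemma chamber_at_position (C D : X) :
  chamber_at C (val (position C D)) = D.
Proof.
pose f (y : nf (lab C)) : X := chamber_at C (val y).
have fmv i j y : f (mv i j y) = mv i j (f y).
  by rewrite /f /= chamber_at_cross //; exact: valP.
rewrite -/(f _) /position /place fmv /=.
have [w wE] := wclass_surj (C.1^-1 * D.1)%g.
rewrite wE place_zero_wclass (morph_steps fmv) fmv.
have -> : mv 0 (ord0 : label PG) (f (nf_base (P := PG) (lab C)))
    = (C.1, ord0) :> gamma_chamber.
  by rewrite /f /= /gamma_mv /= mulg1 invg1 mulg1.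
rewrite gamma_steps -wE mulKVg /= /gamma_mv /= mulg1 invg1 mulg1.
exact/esym/surjective_pairing.
Qed.

Definition distance (C D : X) : W := weyl (val (position C D)).

Lemma distance_self C : distance C C = 1%g.
Proof. by rewrite /distance position_self. Qed.

(** By length, the normal gallery is empty, and its end is D. *)
Lemma distance_eq1 C D : distance C D = 1%g -> C = D.
Proof.
move=> e; have := weyl_length (valP (position C D)).
rewrite -/(distance C D) e -(distance_self C) /distance position_self.
rewrite (@weyl_length PG (lab C) [::]) // => /esym/size0nil y0.
by have := chamber_at_position C D; rewrite y0.
Qed.

Lemma distance_mv C i j D :
  distance C (mv i j D) = distance C D \/
  distance C (mv i j D) = (distance C D * s_ i)%g.
Proof. by rewrite /distance position_mv; apply: weyl_cross; exact: valP. Qed.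

Lemma distance_mv_longer C i j D : j != lab D ->
  cox_length (distance C D * s_ i)%g = (cox_length (distance C D)).+1 ->
  distance C (mv i j D) = (distance C D * s_ i)%g.
Proof.
move=> jD; rewrite /distance position_mv (weyl_length (valP (position C D))).
apply: weyl_cross_longer; first exact: valP.
by rewrite -[end_label _ _]/(lab (position C D)) lab_position.
Qed.

Lemma exists_mv C i D : exists2 j : label PG,
  j != lab D & distance C (mv i j D) = (distance C D * s_ i)%g.
Proof.
have other (j : label PG) : exists j', j' != j.
  exists (if j == ord0 then ord_max else ord0).
  case: (eqVneq j ord0) => [->|]; last by rewrite eq_sym.
  by rewrite -val_eqE /= -lt0n.
have [j jl E] := exists_weyl_cross i (valP (position C D)) other.
exists j; first by rewrite -(lab_position C).
by rewrite /distance position_mv.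
Qed.

Lemma distance_step C i j : j != lab C -> distance C (mv i j C) = s_ i.
Proof.
move=> jC; rewrite /distance position_mv position_self /=.
rewrite -(dir_ofK (Nil ('I_3 * label PG)) i) cross_ascent // (negPf jC).
by rewrite weyl_up // dir_ofK mul1g.
Qed.

(** When every prefix of the type is reduced, each step goes away from C. *)
Lemma joined_distance s C D : joined s C D ->
  cox_length (cox_word A2_tilde s) = size s -> distance C D = cox_word A2_tilde s.
Proof.
elim/last_ind: s D => [|s i IH] D.
  by move=> /= <- _; rewrite distance_self /cox_word big_nil.
rewrite -cats1 => /joined_cat [E pE [j jE <-]].
rewrite cats1 cox_word_rcons size_rcons => len.
have le : (cox_length (cox_word A2_tilde s) <= size s)%N by exact: cox_length_le.
have := cox_length_mul_gen (cox_word A2_tilde s) i; rewrite len ltnS => ge.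
have {le ge}ls : cox_length (cox_word A2_tilde s) = size s.
  by apply/eqP; rewrite eqn_leq le ge.
by have dE := IH E pE ls; rewrite -dE; apply: distance_mv_longer; rewrite // dE len ls.
Qed.

Lemma types_joined (C : X) y : normal (lab C) y -> joined (types y) C (chamber_at C y).
Proof.
elim: y => [|[e j] y IH] //= /and4P [n jy _ _]; rewrite -cats1.
apply/joined_cat; exists (chamber_at C y); first exact: IH.
by exists j => //; rewrite (lab_chamber_at (erefl (lab C))).
Qed.

Lemma distanceC C D : distance D C = (distance C D)^-1%g.
Proof.
have n := valP (position C D); have := types_joined n.
rewrite chamber_at_position => /joined_rev p.
rewrite [distance C D]weylE -cox_word_rev; apply: joined_distance p _.
by rewrite cox_word_rev cox_length_inv -weylE (weyl_length n) size_rev size_types.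
Qed.

(** The hypothesis puts C and C' in a common panel, so that both distances to D
    can be compared from D, where they are those of the chambers of a panel. *)
Lemma distance_WD2 (C C' D : X) i : distance C' C = s_ i ->
  ((distance C' D = s_ i * distance C D \/ distance C' D = distance C D) /\
   (cox_length (s_ i * distance C D) = (cox_length (distance C D)).+1 ->
    distance C' D = s_ i * distance C D))%g.
Proof.
move=> d; have [j jC] := exists_mv C' i C.
rewrite d cox_gen_sq => /distance_eq1 C'E.
have inv w : (w * s_ i = (s_ i * w^-1)^-1)%g by rewrite invMg invgK cox_gen_inv.
rewrite C'E !(distanceC D); split.
  case: (distance_mv D i j C) => ->; first by right.
  by left; rewrite invMg cox_gen_inv.
rewrite -(cox_length_inv (s_ i * _)) invMg invgK cox_gen_inv cox_length_inv.
by move/distance_mv_longer => -> //; rewrite invMg cox_gen_inv.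
Qed.

Lemma distance_WD3 (C D : X) i :
  exists C', distance C' C = s_ i /\ (distance C' D = s_ i * distance C D)%g.
Proof.
have [j jC E] := exists_mv D i C; exists (mv i j C); split.
  by rewrite distanceC distance_step // cox_gen_inv.
by rewrite distanceC E invMg cox_gen_inv -distanceC.
Qed.

Lemma distance_WD1 (C D : X) : distance C D = 1%g <-> C = D.
Proof. by split=> [/distance_eq1|->]; rewrite ?distance_self. Qed.

(** * The lattice *)
Definition gamma_building : building A2_tilde :=
  Building (inhabits ((1%g, ord0) : X)) distance_WD1 distance_WD2 distance_WD3.

Definition translate (g : G) (C : X) : X := ((g * C.1)%g, C.2).

Lemma distance_translate g C D :
  distance (translate g C) (translate g D) = distance C D.
Proof. by rewrite /distance /position /translate /= invMg -!mulgA mulKg. Qed.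

(** A residue of rank 2 is covered by one chart, because each letter of s can be
    cancelled by moving the first chamber inside the chart. *)
Lemma residue_in_chart a phi s x j (D : X) : chart (@mv PG X) a phi ->
  {subset s <= [:: a; a + 1]} -> distance (phi x j) D = cox_word A2_tilde s ->
  exists y k, D = phi y k.
Proof.
move=> ch; elim: s x j => [|i s IH] x j sub.
  rewrite /cox_word big_nil => /distance_eq1 <-; by exists x, j.
rewrite cox_word_cons => d.
have [k kE E] := exists_mv D i (phi x j).
have {}E : distance (mv i k (phi x j)) D = cox_word A2_tilde s.
  by rewrite distanceC E invMg cox_gen_inv -distanceC d mulgA cox_gen_sq mul1g.
have : i \in [:: a; a + 1] by apply: sub; rewrite inE eqxx.
have sub' : {subset s <= [:: a; a + 1]} by move=> z zs; apply: sub; rewrite inE zs orbT.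
rewrite !inE => /orP [] /eqP iE; rewrite iE ?(chart_mv ch) ?(chart_mvS ch) in E;
  exact: IH sub' E.
Qed.

(** A proper set of types omits some m, so it lies in the two types of the finite
    plane m + 1. *)
Lemma gamma_locally_finite : locally_finite gamma_building.
Proof.
move=> J C /properP [_ [m _ mJ]].
have [phi ch [x xE]] := charts (m + 1) (C : X).
apply: (@sub_finite_set _ _
    [set phi y k | y in [set: 'Z_N] & k in [set: 'I_q.+1]]%classic);
  last by apply: finite_image2; exact: finite_finset.
move=> D [s [sJ sE]].
have [y [k ->]] : exists y k, D = phi y k; last by exists y => //; exists k.
apply: (residue_in_chart (s := s) ch _ (_ : distance (phi x (lab (C : X))) D = _)).
  move=> i /sJ iJ; have : i != m by apply: contraNneq mJ => <-.
  by case: (m) => [[|[|[|//]]] ?]; case: (i) => [[|[|[|//]]] ?].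
by rewrite xE.
Qed.

(** The translates of a chamber in a finite residue by elements of its stabilizer
    stay in this residue, and translation is free. *)
Lemma gamma_uniform_lattice : uniform_lattice gamma_building G.
Proof.
split; first exact: gamma_locally_finite.
exists translate; split.
- split=> [[h j]|g h [k j]]; first by rewrite /translate mul1g.
  by rewrite /translate /= mulgA.
- move=> g; split.
    exists (translate g^-1%g) => -[h j]; rewrite /translate /= ?mulKg ?mulKVg //.
  exists 1%g; split=> [i j|C D s]; first by rewrite !perm1.
  have -> : map (1%g : {perm 'I_3}) s = s.
    by rewrite -[RHS]map_id; apply: eq_map => i; rewrite perm1.
  by move=> <-; exact: distance_translate.
- by move=> g /(_ (1%g, ord0)) []; rewrite mulg1.
- exists [set ((1%g, j) : X) | j in [set: 'I_q.+1]]%classic; split.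
    by apply: finite_image; exact: finite_finset.
  move=> [g j]; exists g, (1%g, j); split; first by exists j.
  by rewrite /translate /= mulg1.
move=> J C Jp; have fin := gamma_locally_finite C Jp.
apply: (sub_finite_set _ (finite_image (fun D : X => D.1 * (C : X).1^-1)%g fin)).
move=> g gR.
have CR : residue J C C.
  by exists [::]; split=> //; rewrite /= distance_self /cox_word big_nil.
exists (translate g C); last by rewrite /= mulgK.
by rewrite -gR; exists C.
Qed.

End GammaSystem.

(** * Classical difference sets are perfect *)
Section ProjectivePlane.
Context (F : finFieldType).
Implicit Types (p : Defs.point F) (l : line F).

(** Two planes in a space of dimension 3 meet in dimension at least 1, and in
    dimension 2 only if they are equal. *)
Lemma lines_meet_dim l l' : l != l' -> \dim (sval l :&: sval l')%VS = 1%N.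
Proof.
case: l l' => [U dU] [V dV]; rewrite -val_eqE /= => nUV.
have := dimv_sum_cap U V; rewrite (eqP dU) (eqP dV).
have := dimvS (subvf (U + V)%VS); rewrite dimvf /dim /= mul1n => le3 eq4.
have capU := dimvS (capvSl U V); rewrite (eqP dU) in capU.
suff : \dim (U :&: V)%VS != 2 by move: capU le3 eq4; lia.
apply: contraNN nUV => /eqP d2.
have capE : (U :&: V)%VS = U by apply/eqP; rewrite eqEdim capvSl d2 (eqP dU).
rewrite eqEdim (eqP dU) (eqP dV) leqnn andbT.
by apply/capv_idPl.
Qed.

Lemma lines_meet l l' : l != l' -> exists p, incident p l /\ incident p l'.
Proof.
move=> /lines_meet_dim/eqP d1.
exists (exist (fun U : {vspace 'rV[F]_3} => \dim U == 1%N) _ d1).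
rewrite /incident /=.
by rewrite capvSl capvSr.
Qed.

Lemma lines_meet_uniq l l' p p' : l != l' ->
  incident p l -> incident p l' -> incident p' l -> incident p' l' -> p = p'.
Proof.
move=> /lines_meet_dim d1 pl pl' p'l p'l'.
have E (r : Defs.point F) : incident r l -> incident r l' ->
    sval r = (sval l :&: sval l')%VS.
  case: r => [U dU]; rewrite /incident /= => Ul Ul'.
  by apply/eqP; rewrite eqEdim subv_cap Ul Ul' d1 (eqP dU).
by apply: val_inj; rewrite /= !E.
Qed.

End ProjectivePlane.

(** Points and lines are numbered by Z/N through the Singer cycle. *)
Section SingerOrbits.
Context (F : finFieldType) (s : plane_automorphism F).
Context (p : Defs.point F) (l : line F) (singer : singer_generator s).
Notation N := (singer_order #|F|).

Let N_gt1 : (1 < N)%N.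
Proof. by apply: singer_order_gt1; apply/card_gt0P; exists 0. Qed.

Lemma iter_add (T : Type) (f : T -> T) z (x y : 'Z_N) : iter N f =1 id ->
  iter (x + y)%R f z = iter x f (iter y f z).
Proof.
move=> fN; rewrite -iterD.
have -> : (x + y)%R = ((x + y) %% N)%N :> nat by rewrite /= [X in (_ %% X)%N]Zp_cast.
rewrite [in RHS](divn_eq (x + y)%N N) addnC iterD.
by elim: (_ %/ _)%N => [|n IH] //; rewrite mulSn iterD fN.
Qed.

Definition pt (x : 'Z_N) := iter x (on_points s) p.
Definition ln (x : 'Z_N) := iter x (on_lines s) l.

Lemma incident_iter k p' l' :
  incident (iter k (on_points s) p') (iter k (on_lines s) l') = incident p' l'.
Proof. by elim: k => //= k <-; rewrite plane_aut_incident. Qed.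

Lemma incident_pt_ln x y : incident (pt x) (ln y) = incident p (ln (y - x)).
Proof.
have [_ lN _ _] := singer.
have -> : ln y = iter x (on_lines s) (ln (y - x)).
  by rewrite /ln -iter_add // addrC subrK.
exact: incident_iter.
Qed.

Lemma pt_onto p' : exists x, pt x = p'.
Proof.
have [_ _ /(_ p p') [k [kE _]] _] := singer; exists (k%:R).
by rewrite /pt val_Zp_nat // modn_small.
Qed.

Lemma Zp_lt (x : 'Z_N) : (x < N)%N.
Proof. by rewrite -[X in (_ < X)%N](Zp_cast N_gt1). Qed.

Lemma pt_inj : injective pt.
Proof.
have [_ _ reg _] := singer; move=> x y e.
have [k [_ ku]] := reg p (pt x).
have kx := ku (Ordinal (Zp_lt x)) erefl; have ky := ku (Ordinal (Zp_lt y)) (esym e).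
by apply: val_inj; have := congr1 val (etrans (esym kx) ky).
Qed.

Lemma ln_inj : injective ln.
Proof.
have [_ _ _ reg] := singer; move=> x y e.
have [k [_ ku]] := reg l (ln x).
have kx := ku (Ordinal (Zp_lt x)) erefl; have ky := ku (Ordinal (Zp_lt y)) (esym e).
by apply: val_inj; have := congr1 val (etrans (esym kx) ky).
Qed.

End SingerOrbits.

Section PerfectDifferenceSet.
Context (q : nat) (D : {set 'Z_(singer_order q)}).
Context (D_classical : classical_difference_set D).

(** The lines numbered 0 and u are distinct and so have a common point; if x is
    its number, - x and u - x lie in D. *)
Lemma classical_difference_onto u : u != 0 ->
  exists d d', [/\ d \in D, d' \in D & d - d' = u].
Proof.
case: D_classical => F [s [p [l [qE singer memD]]]] u0; subst q.
have [] := @lines_meet _ (ln s l 0) (ln s l u).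
  by apply: contraNneq u0 => /(ln_inj singer) <-.
move=> p' [p0 pu]; have [x xE] := pt_onto p singer p'.
exists (u - x), (0 - x); rewrite !memD -!(incident_pt_ln p l singer) xE.
by split=> //; ring.
Qed.

(** The points numbered - d' and - e' both lie on the lines numbered 0 and
    d - d', which are distinct. *)
Lemma classical_difference_uniq d d' e e' :
  d \in D -> d' \in D -> e \in D -> e' \in D -> d - d' = e - e' -> d != d' ->
  d = e /\ d' = e'.
Proof.
case: D_classical => F [s [p [l [qE singer memD]]]]; subst q.
move=> dD d'D eD e'D E dd'.
have on x y : (y - x \in D) = incident (pt s p x) (ln s l y).
  by rewrite memD (incident_pt_ln p l singer).
have d'e' : - d' = - e'.
  apply: (pt_inj singer (p := p)).
  apply: (@lines_meet_uniq _ (ln s l 0) (ln s l (d - d'))); rewrite -?on.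
  - by apply: contraNneq dd' => /(ln_inj singer)/esym/eqP; rewrite subr_eq0.
  - by rewrite opprK add0r.
  - by rewrite opprK subrK.
  - by rewrite opprK add0r.
  - by rewrite E opprK subrK.
move/oppr_inj: d'e' => d'e'; split=> //.
by move: E; rewrite d'e' => /addIr.
Qed.

End PerfectDifferenceSet.

Theorem theorem10p3p8 (q : nat)
  (q_prime_power : exists p k : nat, [/\ prime p, (0 < k)%N & q = (p ^ k)%N])
  (Delta : 'I_3 -> {set 'Z_(singer_order q)})
  (Delta_classical : forall a, classical_difference_set (Delta a))
  (Delta0 : forall a, 0%R \in Delta a)
  (delta : 'I_3 -> 'I_q.+1 -> 'Z_(singer_order q))
  (delta_inj : forall a, injective (delta a))
  (delta_onto : forall a, codom (delta a) =i Delta a)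
  (delta0 : forall a, delta a ord0 = 0%R) :
  exists X : building A2_tilde, uniform_lattice X (Gamma delta).
Proof.
have q_gt0 : (0 < q)%N.
  by case: q_prime_power => p [k [/prime_gt0 p0 _ ->]]; rewrite expn_gt0 p0.
have memD a j : delta a j \in Delta a by rewrite -delta_onto codom_f.
have diff_inj a u v u' v' : delta a u - delta a v = delta a u' - delta a v' ->
    u != v -> u = u' /\ v = v'.
  move=> E uv; have := classical_difference_uniq (Delta_classical a)
    (memD a u) (memD a v) (memD a u') (memD a v') E.
  by rewrite (inj_eq (delta_inj a)) => /(_ uv) [/delta_inj -> /delta_inj ->].
have ex (ax : 'I_3 * 'Z_(singer_order q)) : exists uv : 'I_q.+1 * 'I_q.+1,
    delta ax.1 uv.1 - delta ax.1 uv.2 = ax.2.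
  case: ax => a x /=; case: (eqVneq x 0) => [->|x0].
    by exists (ord0, ord0); rewrite subrr.
  have [d [d' []]] := classical_difference_onto (Delta_classical a) x0.
  by rewrite -!delta_onto => /codomP [u ->] /codomP [v ->] <-; exists (u, v).
have [dif difE] := boolp.choice ex.
exists (gamma_building q_gt0 delta0 (fun a x => difE (a, x)) diff_inj).
exact: gamma_uniform_lattice.
Qed.
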